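(* Let $(Z,\beta)$ be an $O(u)$-quasisymmetric structure whose topology is locally compact and second countable. Let $p\in[1,+\infty)$ and $k,\ell\in\mathcal{O}^+(u)$. For every nonempty open $\Omega\subset Z$, $\mathscr{V}^{p;k}_{\ell;\mathrm{loc.}}(\Omega)$ is a unital commutative algebra with a topology (that of the seminorms $\|\cdot\|^{K;\ell}_{p;k}$, $K\subset\Omega$ compact) defined by a countable family of seminorms. Further, if $\varphi:(Z',\beta')\to(Z,\beta)$ is an $O(u)$-quasisymmetric homeomorphism, then for every open $\Omega'\subset Z'$, letting $\Omega=\varphi(\Omega')$, the identity map defines linear continuous algebra homomorphisms $$\mathscr{V}^{p;k}_{\eta\circ\eta'(\ell);\mathrm{loc.}}(\Omega')\hookrightarrow\varphi^*\mathscr{V}^{p;\overline\eta(k)}_{\eta'(\ell);\mathrm{loc.}}(\Omega)\hookrightarrow\mathscr{V}^{p;\overline\eta'\circ\overline\eta(k)}_{\ell;\mathrm{loc.}}(\Omega').$$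
   Context: Throughout, $u:\mathbb{R}_{\ge0}\to\mathbb{R}_{\ge1}$ is nondecreasing, $u(r)/r\to0$ as $r\to+\infty$, and $\sup_r u(2r)/u(r)<\infty$. $O(u)$-quasisymmetric structure on a set $Z$: a set $\beta$ (abstract balls) with a realization map $\beta\to\mathcal{P}(Z)\setminus\{\emptyset\}$, $b\mapsto\widehat b$, a map $\delta:\beta\to\mathbb{Z}$ and a shift $\mathbb{Z}_{\ge0}\times\beta\to\beta$, $(k,b)\mapsto k.b$, such that: (SC0) $k'.k.b=(k'+k).b$ and $\delta(k.b)=\delta(b)-k$; (SC1) for all $k\in\mathbb{Z}_{\ge0}$, $b,b'\in\beta$: (i) $\widehat{k.b}\supseteq\widehat b$; (ii) $\widehat b\subseteq\widehat{b'}$ implies $\widehat{k.b}\subseteq\widehat{k.b'}$; (iii) $\delta(b)<\delta(b')$ implies $\widehat b\nsubseteq\widehat{b'}$; (SC2) there are $n_0\in\mathbb{Z}_{\ge0}$ and $q:\mathbb{Z}_{\ge n_0}\to\mathbb{Z}_{\ge0}$, $q=O(u)$, such that $n_0\le\delta(b)\le\delta(b')$ and $\widehat b\cap\widehat{b'}\ne\emptyset$ imply $\widehat{q(\delta(b)).b}\supset\widehat{b'}$; (SC3) for all $x\ne y$ in $Z$ and $n\in\mathbb{Z}$ there is $b\in\beta$ with $\delta(b)\ge n$, $x\in\widehat b$, $y\notin\widehat b$. Topology: with $E_n=\bigcup_{\delta(b)\ge n}\widehat b\times\widehat b$, a set $\Omega\subset Z$ is open if for every $x\in\Omega$ there is $n$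 such that $(x,y)\in E_n$ implies $y\in\Omega$. An open $\Omega$ inherits the structure $\beta_{\mid\Omega}=\{b\in\beta:\forall k\in\mathbb{Z}_{\ge0},\widehat{k.b}\cap\Omega\ne\emptyset\}$ with realizations $\widehat b\cap\Omega$. $\mathcal{O}^+(u)$: germs at $+\infty$ of functions $v=O(u)$ with values in $\mathbb{Z}_{\ge0}$, defined on large enough integers; $v.b:=v(\delta(b)).b$ for $\delta(b)$ in the domain of $v$. Rings: for $k,j\in\mathcal{O}^+(u)$, $(a^-,a^+)\in\mathcal{P}(Z)^2$ is a $(k,n)$-ring if $\widehat b\subseteq a^-\subseteq a^+\subseteq\widehat{k.b}$ for some $b\in\beta$ with $\delta(b)\ge n$, and a $(j,n)$-outer ring if $a^-\subseteq\widehat b\subseteq\widehat{j.b}\subseteq a^+$ for some $b\in\beta$ with $\delta(b)\ge n$. Their sets are $\mathscr{R}^k_n(\beta)$ and $\mathscr{O}_{j;n}(\beta)$; $\mathscr{R}^k(\beta)$ is the union of $\mathscr{R}^k_n(\beta)$ over $n$ in the domain of $k$. Equivalence, homeomorphisms: for two structures $\beta_1,\beta_2$ on one set, $\beta_2$ is finer than $\beta_1$ if there are $\lambda>0$, $n_0\in\mathbb{Z}$ and maps $\eta,\overline\eta:\mathcal{O}^+(u)\to\mathcal{O}^+(u)$ such that for all $k,j'\in\mathcal{O}^+(u)$ and $n\ge n_0$: $\mathscr{R}^k_n(\beta_1)\subseteq\mathscr{R}^{\eta(k)}_{\lfloor\lambda n\rfloor}(\beta_2)$ and $\mathscr{O}_{\overline\eta(j');n}(\beta_1)\subseteq\mathscr{O}_{j';\lfloor\lambda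 n\rfloor}(\beta_2)$. They are equivalent if each is finer than the other. The bijection $\varphi:(Z',\beta')\to(Z,\beta)$ is an $O(u)$-quasisymmetric homeomorphism if $\beta'$ and the pull-back $\varphi^*\beta$ (same abstract balls as $\beta$, realizations $\varphi^{-1}(\widehat b)$) are equivalent. In the claim, $\eta,\overline\eta:\mathcal{O}^+(u)\to\mathcal{O}^+(u)$ are maps such that, for some $\lambda>0$ and $n_0\in\mathbb{Z}$, for all $k,j'\in\mathcal{O}^+(u)$ and $n\ge n_0$: $\mathscr{R}^k_n(\varphi^*\beta)\subseteq\mathscr{R}^{\eta(k)}_{\lfloor\lambda n\rfloor}(\beta')$ and $\mathscr{O}_{\overline\eta(j');n}(\varphi^*\beta)\subseteq\mathscr{O}_{j';\lfloor\lambda n\rfloor}(\beta')$; and $\eta',\overline\eta':\mathcal{O}^+(u)\to\mathcal{O}^+(u)$ are maps such that, for some $\lambda'>0$ and $n_0'\in\mathbb{Z}$, for all $k,j'\in\mathcal{O}^+(u)$ and $n\ge n_0'$: $\mathscr{R}^k_n(\beta')\subseteq\mathscr{R}^{\eta'(k)}_{\lfloor\lambda' n\rfloor}(\varphi^*\beta)$ and $\mathscr{O}_{\overline\eta'(j');n}(\beta')\subseteq\mathscr{O}_{j';\lfloor\lambda' n\rfloor}(\varphi^*\beta)$. Variation: for a continuous $f:\Omega\to\mathbb{C}$ use the gauge $\phi(a)=\operatorname{diam}f(a)$ on subsets of $\Omega$, $\widetilde\phi^\ell(a)=\sup\{\phi(\widetilde a):(a,\widetilde a)\in\mathscr{R}^\ell\}$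 ($0$ if the set is empty). A $(k,n)$-packing centered on $A$ is a countable collection $\mathscr{P}$ of $(k,n)$-outer rings $\mathbf a=(a^-,a^+)$ with $a^-\cap A\ne\emptyset$ for each member and pairwise disjoint $a^+$ for distinct members. Put $\mathbf V^\ell_{p;k}(f)(A)=\lim_{n\to\infty}\sup_{\mathscr{P}}\sum_{\mathbf a\in\mathscr{P}}\widetilde\phi^\ell(a^-)^p$, supremum over such packings ($0$ if there is none). Rings and outer rings are those of the structure restricted to $\Omega$. $\mathscr{V}^{p;k}_{\ell;\mathrm{loc.}}(\Omega)=\{f\in\mathscr{C}^0(\Omega,\mathbb{C}):\mathbf V^\ell_{p;k}(f)(K)<+\infty\text{ for every compact }K\subset\Omega\}$, with pointwise operations and seminorms $\|f\|^{K;\ell}_{p;k}=\|f\|_{C^0(K)}+\mathbf V^\ell_{p;k}(f)(K)^{1/p}$. $\varphi^*\mathscr{V}(\Omega)=\{f\circ\varphi:f\in\mathscr{V}(\Omega)\}$ with transported topology.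
   Formalization: The union of rings over the domain of ℓ depends on the representative of the germ ℓ on open Ω, and the inclusions can fail for a fixed one; the variation is therefore taken as the limit as the domain of ℓ shrinks to +∞, which depends only on the germ. *)

(* Defs.v *)
From HB Require Import structures.
From mathcomp Require Import all_boot all_order all_algebra.
From mathcomp Require Import all_classical all_reals all_analysis.
From mathcomp Require Import complex.
Set Implicit Arguments.
Unset Strict Implicit.
Unset Printing Implicit Defensive.
Import Order.TTheory GRing.Theory Num.Theory.
Import numFieldNormedType.Exports.
Local Open Scope classical_set_scope.
Local Open Scope ring_scope.

Definition admissible (R : realType) (u : R -> R) : Prop :=
  [/\ forall r, 0 <= r -> 1 <= u r,
      forall r s, 0 <= r -> r <= s -> u r <= u s,
      u r / r @[r --> +oo] --> 0 &
      has_ubound [set u (2 * r) / u r | r in [set r | 0 <= r]]].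

(* Elements of O^+(u) are given by representatives: a function on the integers
   >= odom; the values of ofun below odom are junk and never used. *)
Record Oplus (R : realType) (u : R -> R) := MkOplus {
  odom : int;
  ofun : int -> nat;
  ofunO : (fun n : nat => (ofun n%:Z)%:R : R^o) =O_\oo (fun n => u n%:R : R^o)
}.

(* Same germ, with the domain cut down to the integers >= m. *)
Definition germ_from (R : realType) (u : R -> R) (v : Oplus u) (m : int) :
  Oplus u := MkOplus (Order.max (odom v) m) (ofunO v).

(* Abstract balls, with (SC0) only. The other axioms are in qs_structure, since
   (SC1)(iii) is not inherited by the restriction to an open subset. *)
Record ball_system (Z : Type) := BallSystem {
  ball_of : Type;
  hat : ball_of -> set Z;
  lev : ball_of -> int;
  bshift : nat -> ball_of -> ball_of;
  shiftD : forall j k b, bshift j (bshift k b) = bshift (j + k)%N b;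
  lev_shift : forall k b, lev (bshift k b) = lev b - k%:Z
}.
Arguments hat {Z} b _ _ : rename.
Arguments lev {Z} b _ : rename.
Arguments bshift {Z} b _ _ : rename.

Definition oact (R : realType) (u : R -> R) (Z : Type) (S : ball_system Z)
  (v : Oplus u) (b : ball_of S) : ball_of S := bshift S (ofun v (lev S b)) b.

Record qs_structure (R : realType) (u : R -> R) (Z : Type)
    (S : ball_system Z) : Prop := QsStructure {
  hat_neq0 : forall b, hat S b !=set0;
  SC1i : forall k b, hat S b `<=` hat S (bshift S k b);
  SC1ii : forall k b b', hat S b `<=` hat S b' ->
    hat S (bshift S k b) `<=` hat S (bshift S k b');
  SC1iii : forall b b', lev S b < lev S b' -> ~ (hat S b `<=` hat S b');
  (* n_0 is the lower end of the domain of q *)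
  SC2 : exists2 q : Oplus u, 0 <= odom q & forall b b',
    odom q <= lev S b -> lev S b <= lev S b' ->
    hat S b `&` hat S b' !=set0 -> hat S b' `<=` hat S (oact q b);
  SC3 : forall x y, x <> y -> forall n, exists b,
    [/\ n <= lev S b, hat S b x & ~ hat S b y]
}.

Definition qs_space (Z : Type) (S : ball_system Z) : Type := Z.

Section Topology.
Variables (Z : Type) (S : ball_system Z).

Definition entourage_lev (n : int) : set (Z * Z) :=
  \bigcup_(b in [set b | n <= lev S b]) (hat S b `*` hat S b).

Definition qs_open (O : set Z) : Prop :=
  forall x, O x -> exists n, forall y, entourage_lev n (x, y) -> O y.

Lemma qs_openT : qs_open setT.
Proof. by move=> x _; exists 0. Qed.

Lemma entourage_levS m n : m <= n -> entourage_lev n `<=` entourage_lev m.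
Proof. by move=> mn xy [b nb bxy]; exists b => //=; apply: le_trans nb. Qed.

Lemma qs_openI : setI_closed qs_open.
Proof.
move=> A B oA oB x [/oA[m mA] /oB[n nB]]; exists (Order.max m n) => y xy.
split; [apply: mA|apply: nB]; apply: entourage_levS xy.
- by rewrite le_max lexx.
- by rewrite le_max lexx orbT.
Qed.

Lemma qs_open_bigU (I : Type) (f : I -> set Z) :
  (forall i, qs_open (f i)) -> qs_open (\bigcup_i f i).
Proof. by move=> of_ x [i _ /of_[n nf]]; exists n => y /nf; exists i. Qed.

HB.instance Definition _ := gen_eqMixin (qs_space S).
HB.instance Definition _ := gen_choiceMixin (qs_space S).
HB.instance Definition _ :=
  isOpenTopological.Build (qs_space S) qs_openT qs_openI qs_open_bigU.

End Topology.

Section Restriction.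
Variables (Z : Type) (S : ball_system Z) (O : set (qs_space S)).

Definition restr_ball : Type :=
  {b : ball_of S | forall k, hat S (bshift S k b) `&` O !=set0}.

Lemma restr_shift_subproof (j : nat) (b : restr_ball) (k : nat) :
  hat S (bshift S k (bshift S j (sval b))) `&` O !=set0.
Proof. by rewrite shiftD; exact: (svalP b). Qed.

Definition restr_shift (j : nat) (b : restr_ball) : restr_ball :=
  exist _ (bshift S j (sval b)) (@restr_shift_subproof j b).

Lemma restr_shiftD (j k : nat) (b : restr_ball) :
  restr_shift j (restr_shift k b) = restr_shift (j + k)%N b.
Proof. by apply: eq_exist; rewrite /= shiftD. Qed.

Definition restr_system : ball_system (set_type O) :=
  @BallSystem (set_type O) restr_ball
    (fun b => [set x | hat S (sval b) (set_val x)])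
    (fun b => lev S (sval b)) restr_shift restr_shiftD
    (fun k b => lev_shift k (sval b)).

End Restriction.
Arguments restr_system {Z} S O.

Definition pullback_system (Z' Z : Type) (phi : Z' -> Z) (S : ball_system Z) :
  ball_system Z' :=
  @BallSystem Z' (ball_of S) (fun b => phi @^-1` hat S b) (lev S) (bshift S)
    (@shiftD Z S) (@lev_shift Z S).

Section Rings.
Variables (R : realType) (u : R -> R) (Z : Type) (S : ball_system Z).
Implicit Types (k j : Oplus u) (n : int).

(* k.b only makes sense when lev b is in the domain of k. *)
Definition rings k n : set (set Z * set Z) := [set a | exists b,
  [/\ n <= lev S b, odom k <= lev S b, hat S b `<=` a.1, a.1 `<=` a.2 &
      a.2 `<=` hat S (oact k b)]].

Definition outer_rings j n : set (set Z * set Z) := [set a | exists b,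
  [/\ n <= lev S b, odom j <= lev S b, a.1 `<=` hat S b,
      hat S b `<=` hat S (oact j b) & hat S (oact j b) `<=` a.2]].

Definition all_rings k : set (set Z * set Z) :=
  \bigcup_(n in [set n | odom k <= n]) rings k n.

End Rings.

Definition ring_control (R : realType) (u : R -> R) (Z : Type)
    (S1 S2 : ball_system Z) (eta etab : Oplus u -> Oplus u) : Prop :=
  exists lam : R, exists n0 : int, 0 < lam /\
    forall (k j : Oplus u) (n : int), n0 <= n ->
      rings S1 k n `<=` rings S2 (eta k) (Num.floor (lam * n%:~R)) /\
      outer_rings S1 (etab j) n `<=`
        outer_rings S2 j (Num.floor (lam * n%:~R)).

Definition finer (R : realType) (u : R -> R) (Z : Type)
    (S1 S2 : ball_system Z) : Prop :=
  exists eta etab : Oplus u -> Oplus u, ring_control S1 S2 eta etab.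

Definition qs_homeo (R : realType) (u : R -> R) (Z' Z : Type)
    (S' : ball_system Z') (S : ball_system Z) (phi : Z' -> Z) : Prop :=
  [/\ bijective phi, finer u S' (pullback_system phi S) &
      finer u (pullback_system phi S) S'].

Section Variation.
Local Open Scope ereal_scope.
Variables (R : realType) (u : R -> R) (X : Type) (S : ball_system X).
Implicit Types (f : X -> R[i]) (A : set X) (k l : Oplus u).

(* Suprema in [0, +oo]: adding 0 gives the value 0 to an empty supremum. *)
Definition esup0 (E : set (\bar R)) : \bar R := ereal_sup ([set 0] `|` E).

Definition diam_im f A : \bar R :=
  esup0 [set (complex.Re `|f x - f y|%R)%:E | x in A & y in A].

Definition gauge_env l f A : \bar R :=
  esup0 [set diam_im f B | B in [set B | all_rings S l (A, B)]].

Definition packing k (n : int) A (P : set (set X * set X)) : Prop :=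
  [/\ countable P, P `<=` outer_rings S k n,
      forall a, P a -> a.1 `&` A !=set0 &
      forall a a', P a -> P a' -> a <> a' -> a.2 `&` a'.2 = set0].

Definition Vvar_rep (p : R) k l f A : \bar R :=
  limn (fun n : nat => esup0
    [set \esum_(a in P) (gauge_env l f a.1 `^ p) | P in packing k n%:Z A]).

(* Vvar_rep depends on k only through its germ. The same holds for l if
   (SC1)(iii) holds in S, since hat b <= a^- <= hat b0 then forces
   lev b0 <= lev b. But (SC1)(iii) may fail in restr_system S O (some b of low
   level may have a tiny trace on O), and Vvar_rep then depends on the domain
   of the representative l. To get a quantity attached to the germ, take the
   limit over representatives; it is monotone, since Vvar_rep can only decrease
   when the domain of l shrinks. *)
Definition Vvar (p : R) k l f A : \bar R :=
  limn (fun m : nat => Vvar_rep p k (germ_from l m%:Z) f A).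

End Variation.

Definition continuousC (R : realType) (X : topologicalType) (f : X -> R[i]) :=
  continuous (f : X -> (R[i] : numClosedFieldType)).

Definition Vloc (R : realType) (u : R -> R) (X : topologicalType)
    (S : ball_system X) (p : R) (k l : Oplus u) : set (X -> R[i]) :=
  [set f | continuousC f /\
     forall K : set X, compact K -> (Vvar S p k l f K < +oo)%E].

Definition Vnorm (R : realType) (u : R -> R) (X : topologicalType)
    (S : ball_system X) (p : R) (k l : Oplus u) (K : set X) (f : X -> R[i]) :
    \bar R :=
  (esup0 [set (complex.Re `|f x|%R)%:E | x in K] +
   Vvar S p k l f K `^ p^-1)%E.

Section FunctionAlgebras.
Variables (R : realType) (X : Type).
Implicit Types (V : set (X -> R[i])) (f g : X -> R[i]).

(* Commutativity is inherited from the algebra of all functions X -> C. *)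
Definition unital_subalgebra V : Prop :=
  [/\ V (fun=> 1), forall f g, V f -> V g -> V (fun x => f x + g x),
      forall f g, V f -> V g -> V (fun x => f x * g x) &
      forall (c : R[i]) f, V f -> V (fun x => c * f x)].

Definition seminorm_on V (N : (X -> R[i]) -> \bar R) : Prop :=
  [/\ forall f, V f -> (0 <= N f < +oo)%E,
      forall f g, V f -> V g -> (N (fun x => (f x + g x)%R) <= N f + N g)%E &
      forall (c : R[i]) f, V f ->
        N (fun x => c * f x) = ((complex.Re `|c|)%:E * N f)%E].

Definition seminorm_space V (I : Type) (N : I -> (X -> R[i]) -> \bar R) : Type :=
  set_type V.

Section SeminormTopology.
Variables (V : set (X -> R[i])) (I : Type) (N : I -> (X -> R[i]) -> \bar R).

Definition seminorm_open (U : set V) : Prop := forall f : V, U f ->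
  exists2 D : set I, finite_set D & exists2 e : R, 0 < e & forall g : V,
    (forall i, D i -> (N i (fun x => (val g x - val f x)%R) < e%:E)%E) -> U g.

Lemma seminorm_openT : seminorm_open setT.
Proof. by move=> f _; exists set0 => //; exists 1. Qed.

Lemma seminorm_openI : setI_closed seminorm_open.
Proof.
move=> A B oA oB f [/oA[D fD [d d0 dA]] /oB[E fE [e e0 eB]]].
exists (D `|` E); first by rewrite finite_setU.
exists (Order.min d e); first by rewrite lt_min d0.
move=> g gDE; split; [apply: dA|apply: eB] => i Di.
- apply: lt_le_trans (gDE i _) _; first by left.
  by rewrite lee_fin ge_min lexx.
- apply: lt_le_trans (gDE i _) _; first by right.
  by rewrite lee_fin ge_min lexx orbT.
Qed.

Lemma seminorm_open_bigU (J : Type) (F : J -> set V) :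
  (forall j, seminorm_open (F j)) -> seminorm_open (\bigcup_j F j).
Proof.
move=> oF f [j _ /oF[D fD [d d0 dF]]]; exists D => //; exists d => // g /dF.
by exists j.
Qed.

HB.instance Definition _ := gen_eqMixin (seminorm_space V N).
HB.instance Definition _ := gen_choiceMixin (seminorm_space V N).
HB.instance Definition _ := isOpenTopological.Build (seminorm_space V N)
  seminorm_openT seminorm_openI seminorm_open_bigU.

End SeminormTopology.

Definition countably_seminormed V (I : Type) (N : I -> (X -> R[i]) -> \bar R) :
    Prop :=
  exists2 q : nat -> (X -> R[i]) -> \bar R, forall i, seminorm_on V (q i) &
    forall U : set V, @open (seminorm_space V N) U <->
                      @open (seminorm_space V q) U.

Definition algebra_hom (V W : set (X -> R[i])) (i : V -> W) : Prop :=
  [/\ unital_subalgebra V, unital_subalgebra W &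
   [/\ forall f : V, val f = (fun=> 1) -> val (i f) = (fun=> 1),
       forall (c : R[i]) (f g h : V),
        val h = (fun x => c * val f x + val g x) ->
        val (i h) = (fun x => c * val (i f) x + val (i g) x) &
       forall f g h : V, val h = (fun x => val f x * val g x) ->
        val (i h) = (fun x => val (i f) x * val (i g) x)]].

End FunctionAlgebras.

Definition Vspace (R : realType) (u : R -> R) (X : topologicalType)
    (S : ball_system X) (p : R) (k l : Oplus u) : topologicalType :=
  seminorm_space (Vloc S p k l)
    (fun K : {K : set X | compact K} => Vnorm S p k l (sval K)).

(* For a bijection h, this is the topology making h a homeomorphism. *)
Definition transported_space (T A : Type) (h : T -> A) : Type := A.

Section Transport.
Variables (T : topologicalType) (A : Type) (h : T -> A).

Definition transported_open (U : set A) : Prop := open (h @^-1` U).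

Lemma transported_openT : transported_open setT.
Proof. exact: openT. Qed.

Lemma transported_openI : setI_closed transported_open.
Proof. by move=> B C oB oC; exact: openI. Qed.

Lemma transported_open_bigU (I : Type) (F : I -> set A) :
  (forall i, transported_open (F i)) -> transported_open (\bigcup_i F i).
Proof.
by move=> oF; rewrite /transported_open preimage_bigcup; apply: bigcup_open => i _; exact: oF.
Qed.

HB.instance Definition _ := gen_eqMixin (transported_space h).
HB.instance Definition _ := gen_choiceMixin (transported_space h).
HB.instance Definition _ := isOpenTopological.Build (transported_space h)
  transported_openT transported_openI transported_open_bigU.

End Transport.

Section PullBack.
Variables (R : realType) (X Y : Type) (psi : X -> Y) (V : set (Y -> R[i])).

Definition pullback_funs : set (X -> R[i]) := [set f \o psi | f in V].

Definition pullback_map (f : V) : pullback_funs :=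
  exist _ (val f \o psi) (mem_set (imageP (fun g : Y -> R[i] => g \o psi) (set_valP f))).

End PullBack.

Definition restr_map (X Y : Type) (phi : X -> Y) (A : set X) (x : A) :
  (phi @` A) := exist _ (phi (val x)) (mem_set (imageP phi (set_valP x))).

Definition pullback_Vspace (R : realType) (u : R -> R) (X : Type)
    (Y : topologicalType) (psi : X -> Y) (S : ball_system Y) (p : R)
    (k l : Oplus u) : topologicalType :=
  @transported_space (Vspace S p k l) _ (pullback_map psi (V:=Vloc S p k l)).

(* Main.v *)
Require Import Defs.
From HB Require Import structures.
From mathcomp Require Import all_boot all_order all_algebra.
From mathcomp Require Import all_classical all_reals all_analysis.
From mathcomp Require Import complex.
From mathcomp Require Import zify ring.
Set Implicit Arguments.
Unset Strict Implicit.
Unset Printing Implicit Defensive.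
Import Order.TTheory GRing.Theory Num.Theory.
Import numFieldNormedType.Exports.
Local Open Scope classical_set_scope.
Local Open Scope ring_scope.

(** Two facts carry the theorem.

    The first is analytic. Call [vnorm] the p-th root of the variation on a
    set A. The variation is an infimum, over two thresholds m and n, of
    suprema over packings of sums of p-th powers of gauges [VvarE]. If at high
    levels the oscillation of h on the outer set of any ring whose inner set
    meets A is at most M times the sum of the oscillations of f and g, then
    [vnorm h A <= M * (vnorm f A + vnorm g A)]: this is [vnorm_comb], which
    rests on Minkowski's inequality [esum_minkowski]. With M = 1 it gives the
    triangle inequality, with M = |c| homogeneity. For a product fg one takes
    for M a bound of |f| and |g| near a compact set K: functions of O^+(u) are
    o(n) [Oplus_sublinear], so the outer set of a ring meeting K is contained
    in a ball of high level, hence in a small neighbourhood of K, on which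
    continuous functions are bounded [compact_qnear_bounded].

    The second is topological. By (SC2) the relations of lying in a common
    ball of level at least n are the entourages of a uniform structure
    [qnear_comp]. It may fail to be separated, but closures of small balls are
    small, so an open subset of a locally compact second countable Z has a
    sequence of compact subsets such that each compact subset lies in one of
    them [compact_exhaustion]; monotonicity of the norms in K then gives a
    countable family of seminorms.

    For the two inclusions the roles of Z and Z' are symmetric, so both are
    instances of one statement about a bijection h : Z1 -> Z2 that pulls rings
    and outer rings of Z2 back to rings and outer rings of Z1
    [ring_transfer]. The pair (hat b, hat b) is a ring as soon as the level of
    b is large; pulling it back shows that the inverse of h is uniformly
    continuous [transfer_qnear]. For a compact K in the open set O2, the balls
    carrying the rings of high level that meet K lie inside O2, so rings of the
    restricted structures that meet K are transferred as well
    [transfer_restr_rings]. Preimage by h then maps packings to packings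
    without decreasing the gauges [vnorm_transfer], which bounds each norm on
    O2 by a norm on O1; this is both the inclusion of function spaces and its
    continuity. *)

(** * Modulus, suprema and powers in the extended reals *)

Section Modulus.
Variable R : realType.
Implicit Types z w : R[i].

(** The norm of [R[i]] takes its values in [R[i]]; this is its real value. *)
Definition cmod z : R := complex.Re `|z|.

Lemma cmodE z : `|z| = (cmod z)%:C%C.
Proof. by rewrite /cmod RRe_real ?normr_real. Qed.

Lemma cmod_ge0 z : 0 <= cmod z.
Proof. by rewrite -lecR -cmodE; exact: normr_ge0. Qed.

Lemma cmod0 : cmod 0 = 0.
Proof. by rewrite /cmod normr0. Qed.

Lemma cmodD z w : cmod (z + w) <= cmod z + cmod w.
Proof. by rewrite -lecR rmorphD /= -!cmodE ler_normD. Qed.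

Lemma cmodM z w : cmod (z * w) = cmod z * cmod w.
Proof. by rewrite {1}/cmod normrM !cmodE -rmorphM. Qed.

Lemma cmod_eq0 z : cmod z = 0 -> z = 0.
Proof. by move=> z0; apply/eqP; rewrite -normr_eq0 cmodE z0. Qed.

End Modulus.

Section ExtendedReals.
Variable R : realType.
Local Open Scope ereal_scope.
Implicit Types (E : set (\bar R)) (x y : \bar R) (p a b : R).

Lemma esup0_ge0 E : 0 <= esup0 E.
Proof. by apply: ereal_sup_ubound; left. Qed.

Lemma esup0_ubound E x : E x -> x <= esup0 E.
Proof. by move=> Ex; apply: ereal_sup_ubound; right. Qed.

Lemma esup0_le E y : 0 <= y -> (forall x, E x -> x <= y) -> esup0 E <= y.
Proof. by move=> y0 Ey; apply: ge_ereal_sup => x [->//|/Ey]. Qed.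

Lemma le_esup0 E E' : (forall x, E x -> exists2 y, E' y & x <= y) ->
  esup0 E <= esup0 E'.
Proof.
move=> EE'; apply: esup0_le (esup0_ge0 _) _ => x /EE'[y E'y xy].
exact: le_trans xy (esup0_ubound E'y).
Qed.

Lemma le_poweR p x y : (0 <= p)%R -> 0 <= x -> x <= y -> x `^ p <= y `^ p.
Proof.
move=> p0 x0 xy; apply: gt0_ler_poweR => //; rewrite in_itv /= leey andbT //.
exact: le_trans xy.
Qed.

Lemma poweRK p x : (0 < p)%R -> 0 <= x -> (x `^ p) `^ p^-1 = x.
Proof. by move=> p0 x0; rewrite -poweRrM mulfV ?gt_eqF// poweRe1. Qed.

Lemma lt_poweRV p x y : (0 < p)%R -> 0 <= x -> x `^ p^-1 < y -> x < y `^ p.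
Proof.
move=> p0 x0; apply: contraTT; rewrite -!leNgt => yx.
have [y0|/ltW y0] := leP 0 y; last by rewrite (le_trans y0)// poweR_ge0.
rewrite -[leLHS](poweRK p0 y0); apply: le_poweR yx; last exact: poweR_ge0.
by rewrite invr_ge0 ltW.
Qed.

Lemma esumZ_le (T : choiceType) (P : set T) (F : T -> \bar R) (c : R) :
  (0 <= c)%R -> (forall i, 0 <= F i) ->
  \esum_(i in P) (c%:E * F i) <= c%:E * \esum_(i in P) F i.
Proof.
move=> c0 F0; apply: ge_ereal_sup => _ [X [fX XP] <-].
rewrite -ge0_mule_fsumr//.
by apply: lee_wpmul2l; [rewrite lee_fin|apply: esum_ge; exists X].
Qed.

(** Convexity of the p-th power, at the points x(a+b)/a and y(a+b)/b with
    weights a/(a+b) and b/(a+b). *)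
Lemma powR_convexD p a b (x y : R) : (1 <= p)%R -> (0 < a)%R -> (0 < b)%R ->
  (0 <= x)%R -> (0 <= y)%R ->
  ((x + y) `^ p <= (a + b) `^ (p - 1) * a `^ (1 - p) * x `^ p +
    (a + b) `^ (p - 1) * b `^ (1 - p) * y `^ p)%R.
Proof.
move=> p1 a0 b0 x0 y0.
have ab0 : (0 < a + b)%R by rewrite addr_gt0.
have abn : (a + b != 0)%R by rewrite gt_eqF.
have coef c z : (0 < c)%R -> (0 <= z)%R ->
  ((a + b) `^ (p - 1) * c `^ (1 - p) * z `^ p =
    c / (a + b) * (z * (a + b) / c) `^ p)%R.
  move=> c0 z0; rewrite powRM ?mulr_ge0 ?invr_ge0 ?(ltW ab0) ?(ltW c0)//.
  rewrite (powRM _ z0 (ltW ab0)).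
  have -> : ((c^-1)%R `^ p = c `^ (- p))%R.
    by rewrite -(powR_inv1 (ltW c0)) -powRrM mulN1r.
  have -> : ((a + b) `^ p = (a + b) `^ (p - 1) * (a + b))%R.
    by rewrite -[X in (_ * X)%R](powRr1 (ltW ab0)) -powRD ?subrK// abn implybT.
  have -> : (c `^ (1 - p) = c * c `^ (- p))%R.
    by rewrite -[X in _ = (X * _)%R](powRr1 (ltW c0)) -powRD ?(gt_eqF c0) ?implybT.
  by field.
rewrite !coef//.
have t0 : (0 <= a / (a + b))%R by rewrite divr_ge0 // ltW.
have t1 : (a / (a + b) <= 1)%R by rewrite ler_pdivrMr// mul1r lerDl ltW.
have := @convex_powR R p p1 (Itv01 t0 t1) (x * (a + b) / a)%R
  (y * (a + b) / b)%R.
rewrite !inE /= !in_itv /= !andbT.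
move=> /(_ (divr_ge0 (mulr_ge0 x0 (ltW ab0)) (ltW a0))).
move=> /(_ (divr_ge0 (mulr_ge0 y0 (ltW ab0)) (ltW b0))).
rewrite !convRE /= /unstable.onem.
have -> : (1 - a / (a + b) = b / (a + b))%R by field.
apply: le_trans; rewrite [X in (_ <= X `^ p)%R]convRE /= /unstable.onem.
have -> : (1 - a / (a + b) = b / (a + b))%R by field.
rewrite le_eqVlt; apply/orP; left; apply/eqP; congr (_ `^ p)%R.
by field; rewrite abn !gt_eqF.
Qed.

(** Linearization of (x + y)^p with coefficients independent of x and y, sharp
    at (x, y) = (a, b); this is what makes it summable over a packing. *)
Lemma poweR_convexD p a b x y : (1 <= p)%R -> (0 < a)%R -> (0 < b)%R ->
  0 <= x -> 0 <= y ->
  (x + y) `^ p <=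
    ((a + b) `^ (p - 1) * a `^ (1 - p))%:E * x `^ p +
    ((a + b) `^ (p - 1) * b `^ (1 - p))%:E * y `^ p.
Proof.
move=> p1 a0 b0; have pn0 : p != 0%R by rewrite gt_eqF// (lt_le_trans _ p1).
have c0 c : (0 < c)%R -> (0 < (a + b) `^ (p - 1) * c `^ (1 - p))%R.
  by move=> c0; rewrite mulr_gt0 ?powR_gt0 ?addr_gt0.
case: x => [x| |]// x0; case: y => [y| |]// y0.
- rewrite -EFinD !poweR_EFin -!EFinM -EFinD lee_fin.
  exact: powR_convexD.
- rewrite (poweRyr pn0) gt0_muley ?lte_fin ?c0// poweR_EFin -EFinM addey//.
- rewrite (poweRyr pn0) gt0_muley ?lte_fin ?c0// poweR_EFin -EFinM addye//.
- rewrite (poweRyr pn0) !gt0_muley ?lte_fin ?c0// addye//.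
Qed.
End ExtendedReals.

(** * The variation as an infimum over levels *)

Section VariationTheory.
Local Open Scope ereal_scope.
Variables (R : realType) (u : R -> R) (X : Type) (S : ball_system X).
Implicit Types (f g h : X -> R[i]) (A : set X) (k l : Oplus u) (p : R).

Definition packing_sup p k l f A (n : int) : \bar R := esup0
  [set \esum_(a in P) (gauge_env S l f a.1 `^ p) | P in packing S k n A].

Lemma packing_sup_ge0 p k l f A n : 0 <= packing_sup p k l f A n.
Proof. exact: esup0_ge0. Qed.

Lemma gauge_env_ge0 l f A : 0 <= gauge_env S l f A.
Proof. exact: esup0_ge0. Qed.

Lemma esum_gauge_le p k l f A n P : packing S k n A P ->
  \esum_(a in P) (gauge_env S l f a.1 `^ p) <= packing_sup p k l f A n.
Proof. by move=> kP; apply: esup0_ubound; exists P. Qed.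

Lemma packing_sub k (n n' : int) A A' P : (n <= n')%R -> A `<=` A' ->
  packing S k n' A P -> packing S k n A' P.
Proof.
move=> nn AA [cP oP PA dP]; split=> //.
- move=> a /oP[b [n'b kb ab bb ba]]; exists b; split=> //.
  exact: le_trans n'b.
- by move=> a /PA[x [ax Ax]]; exists x; split=> //; apply: AA.
Qed.

Lemma all_rings_germ l (m m' : nat) : (m <= m')%N ->
  all_rings S (germ_from l m'%:Z) `<=` all_rings S (germ_from l m%:Z).
Proof.
move=> mm a [n /= mn [b [nb mb b1 a12 ab]]].
exists (odom (germ_from l m%:Z)) => //=.
have le_max_mm : (Order.max (odom l) m%:Z <= lev S b)%R.
  apply: le_trans mb; rewrite /= ge_max le_max lexx /= le_max.
  by rewrite lez_nat mm orbT.
by exists b; split.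
Qed.

Lemma packing_sup_anti p k l f A (m m' : nat) (n n' : int) :
  (0 <= p)%R -> (m <= m')%N -> (n <= n')%R ->
  packing_sup p k (germ_from l m'%:Z) f A n' <=
  packing_sup p k (germ_from l m%:Z) f A n.
Proof.
move=> p0 mm nn; apply: le_esup0 => _ [P kP <-].
exists (\esum_(a in P) (gauge_env S (germ_from l m%:Z) f a.1 `^ p)).
  by exists P => //; exact: packing_sub kP.
apply: le_esum => a Pa; apply: le_poweR => //; first exact: gauge_env_ge0.
apply: le_esup0 => _ [B lB <-]; exists (diam_im f B) => //.
by exists B => //; exact: all_rings_germ lB.
Qed.

(** Raising the thresholds m and n leaves fewer rings and fewer packings, so
    both limits are limits of nonincreasing sequences. *)
Lemma VvarE p k l f A : (0 <= p)%R -> Vvar S p k l f A =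
  ereal_inf (range (fun m : nat => ereal_inf (range (fun n : nat =>
    packing_sup p k (germ_from l m%:Z) f A n%:Z)))).
Proof.
move=> p0; apply/cvg_lim => //.
have inner m : Vvar_rep S p k (germ_from l m%:Z) f A =
    ereal_inf (range (fun n : nat =>
      packing_sup p k (germ_from l m%:Z) f A n%:Z)).
  apply/cvg_lim => //; apply: ereal_nonincreasing_cvgn => n n' nn.
  by apply: packing_sup_anti; rewrite ?lez_nat.
under eq_fun do rewrite inner.
apply: ereal_nonincreasing_cvgn => m m' mm.
apply/ereal_infP => _ [n _ <-]; apply: ge_ereal_inf.
exists (packing_sup p k (germ_from l m'%:Z) f A n%:Z); first by exists n.
exact: packing_sup_anti.
Qed.

Lemma Vvar_le p k l f A (m n : nat) : (0 <= p)%R ->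
  Vvar S p k l f A <= packing_sup p k (germ_from l m%:Z) f A n%:Z.
Proof.
move=> p0; rewrite VvarE//.
apply: ge_ereal_inf; eexists; first by exists m.
by apply: ereal_inf_lbound; exists n.
Qed.

Lemma Vvar_ge p k l f A y : (0 <= p)%R ->
  (forall m n : nat, y <= packing_sup p k (germ_from l m%:Z) f A n%:Z) ->
  y <= Vvar S p k l f A.
Proof.
move=> p0 yW; rewrite VvarE//; apply/ereal_infP => _ [m _ <-].
by apply/ereal_infP => _ [n _ <-].
Qed.

Lemma Vvar_ge0 p k l f A : (0 <= p)%R -> 0 <= Vvar S p k l f A.
Proof. by move=> p0; apply: Vvar_ge => // *; exact: packing_sup_ge0. Qed.

Lemma Vvar_lt p k l f A y : (0 <= p)%R -> Vvar S p k l f A < y ->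
  exists m n : nat, packing_sup p k (germ_from l m%:Z) f A n%:Z < y.
Proof.
move=> p0; apply: contraPP => /forallNP H; apply/negP; rewrite -leNgt.
apply: Vvar_ge => // m n; rewrite leNgt; apply/negP => lty.
by apply: (H m); exists n.
Qed.
End VariationTheory.

(** * Minkowski's inequality and the calculus of variations *)

Section Minkowski.
Local Open Scope ereal_scope.
Variables (R : realType) (T : choiceType) (P : set T) (p : R).
Implicit Types (F G : T -> \bar R) (a b : R).
Hypothesis p1 : (1 <= p)%R.

(** The coefficients in [poweR_convexD] recombine a^p and b^p into
    (a + b)^p. *)
Lemma esum_minkowski F G a b : (0 < a)%R -> (0 < b)%R ->
  (forall i, 0 <= F i) -> (forall i, 0 <= G i) ->
  \esum_(i in P) (F i `^ p) <= (a `^ p)%:E ->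
  \esum_(i in P) (G i `^ p) <= (b `^ p)%:E ->
  \esum_(i in P) ((F i + G i) `^ p) <= ((a + b) `^ p)%:E.
Proof.
move=> a0 b0 F0 G0 Fa Gb.
have ab0 : (0 < a + b)%R by rewrite addr_gt0.
pose w c := ((a + b) `^ (p - 1) * c `^ (1 - p))%R.
have w0 c : (0 <= w c)%R by rewrite mulr_ge0 ?powR_ge0.
have wE c : (0 < c)%R -> (w c * c `^ p = (a + b) `^ (p - 1) * c)%R.
  move=> c0; rewrite /w -mulrA -powRD ?subrK ?powRr1 ?(ltW c0)//.
  by rewrite (gt_eqF c0) implybT.
apply: le_trans (_ : \esum_(i in P) ((w a)%:E * F i `^ p + (w b)%:E * G i `^ p)
   <= _).
  by apply: le_esum => i _; exact: poweR_convexD.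
rewrite esumD; last 2 first.
- by move=> i _; rewrite mule_ge0 ?lee_fin ?poweR_ge0.
- by move=> i _; rewrite mule_ge0 ?lee_fin ?poweR_ge0.
have -> : ((a + b) `^ p = w a * a `^ p + w b * b `^ p)%R.
  rewrite !wE// -mulrDr -[X in (_ = _ * X)%R](powRr1 (ltW ab0)) -powRD ?subrK//.
  by rewrite (gt_eqF ab0) implybT.
rewrite EFinD !EFinM; apply: leeD.
- apply: le_trans (esumZ_le _ (w0 a) _) _; first by move=> i; exact: poweR_ge0.
  by apply: lee_wpmul2l; rewrite ?lee_fin.
- apply: le_trans (esumZ_le _ (w0 b) _) _; first by move=> i; exact: poweR_ge0.
  by apply: lee_wpmul2l; rewrite ?lee_fin.
Qed.

Lemma esum_poweRZ_le F a (M : R) : (0 <= M)%R -> (0 <= a)%R ->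
  (forall i, 0 <= F i) ->
  \esum_(i in P) (F i `^ p) <= (a `^ p)%:E ->
  \esum_(i in P) ((M%:E * F i) `^ p) <= ((M * a) `^ p)%:E.
Proof.
move=> M0 a0 F0 Fa.
under eq_esum do rewrite poweRM ?lee_fin// poweR_EFin.
apply: le_trans (esumZ_le _ (powR_ge0 _ _) _) _.
  by move=> i; exact: poweR_ge0.
by rewrite powRM// EFinM; apply: lee_wpmul2l; rewrite ?lee_fin ?powR_ge0.
Qed.

End Minkowski.

Section VariationCalculus.
Local Open Scope ereal_scope.
Variables (R : realType) (u : R -> R) (X : Type) (S : ball_system X).
Variables (p : R) (k l : Oplus u).
Hypothesis p1 : (1 <= p)%R.
Implicit Types (f g h : X -> R[i]) (A B C : set X).

Let p0 : (0 < p)%R. Proof. exact: lt_le_trans p1. Qed.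

Lemma diam_im_le f C x y : C x -> C y -> (cmod (f x - f y))%:E <= diam_im f C.
Proof. by move=> Cx Cy; apply: esup0_ubound; exists x => //; exists y. Qed.

Lemma gauge_env_le (l' : Oplus u) f B C :
  all_rings S l' (B, C) -> diam_im f C <= gauge_env S l' f B.
Proof. by move=> BC; apply: esup0_ubound; exists C. Qed.

(** The gauge of B only sees the values on the outer sets C of the rings with
    inner set B. *)
Lemma gauge_env_comb (l' : Oplus u) f g h (M : R) B : (0 <= M)%R ->
  (forall C, all_rings S l' (B, C) -> forall x y, C x -> C y ->
    (cmod (h x - h y) <= M * (cmod (f x - f y) + cmod (g x - g y)))%R) ->
  gauge_env S l' h B <=
    M%:E * gauge_env S l' f B + M%:E * gauge_env S l' g B.
Proof.
move=> M0 hM; rewrite -ge0_muleDr ?gauge_env_ge0//.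
have rhs0 : 0 <= M%:E * (gauge_env S l' f B + gauge_env S l' g B).
  by rewrite mule_ge0 ?lee_fin// adde_ge0 ?gauge_env_ge0.
apply: esup0_le => // _ [C BC <-]; apply: esup0_le => // _ [x Cx [y Cy <-]].
apply: le_trans (_ : (M * (cmod (f x - f y) + cmod (g x - g y)))%:E <= _).
  by rewrite lee_fin; apply: hM BC _ _ Cx Cy.
rewrite EFinM EFinD; apply: lee_wpmul2l; first by rewrite lee_fin.
by apply: leeD; apply: le_trans (gauge_env_le _ BC); exact: diam_im_le.
Qed.

(** The part of the seminorm that comes from the variation. *)
Definition vnorm f A : \bar R := Vvar S p k l f A `^ p^-1.

Lemma vnorm_ge0 f A : 0 <= vnorm f A.
Proof. exact: poweR_ge0. Qed.

Lemma vnorm_lty f A : (Vvar S p k l f A < +oo) = (vnorm f A < +oo).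
Proof.
apply/idP/idP; first exact: poweR_lty.
by apply: lty_poweRy; rewrite invr_eq0 gt_eqF.
Qed.

Lemma vnorm_lt f A (a : R) : vnorm f A < a%:E -> exists m n : nat,
  packing_sup S p k (germ_from l m%:Z) f A n%:Z <= (a `^ p)%:E.
Proof.
move/(lt_poweRV p0 (Vvar_ge0 _ _ _ _ _ (ltW p0)))/(Vvar_lt (ltW p0)).
by move=> [m [n /ltW Wa]]; exists m, n.
Qed.

Lemma vnorm_le f A (m n : nat) (a : R) : (0 <= a)%R ->
  packing_sup S p k (germ_from l m%:Z) f A n%:Z <= (a `^ p)%:E ->
  vnorm f A <= a%:E.
Proof.
move=> a0 Wa; rewrite -[leRHS](@poweRK R p)// ?lee_fin//.
apply: le_poweR; rewrite ?invr_ge0 ?(ltW p0) ?Vvar_ge0 ?(ltW p0)//.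
exact: le_trans (Vvar_le _ _ _ _ _ _ _ (ltW p0)) Wa.
Qed.

(** The norm inequality behind sums, products and scalar multiples: it is
    enough to compare oscillations on outer sets of rings of high level that
    meet A. *)
Lemma vnorm_comb f g h A (M : R) : (0 < M)%R ->
  (exists m0 : nat, forall B C,
    B `&` A !=set0 -> all_rings S (germ_from l m0%:Z) (B, C) ->
    forall x y, C x -> C y ->
    (cmod (h x - h y) <= M * (cmod (f x - f y) + cmod (g x - g y)))%R) ->
  vnorm f A < +oo -> vnorm g A < +oo ->
  vnorm h A <= M%:E * (vnorm f A + vnorm g A).
Proof.
move=> M0 [m0 hM] ffin gfin; have Mge0 := ltW M0.
have step a b : vnorm f A < a%:E -> vnorm g A < b%:E ->
    vnorm h A <= (M * (a + b))%:E.
  move=> fa gb.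
  (* The strict bounds are attained by packing suprema at some thresholds,
     which are then raised to common ones. *)
  have a0 : (0 < a)%R by rewrite -lte_fin (le_lt_trans (vnorm_ge0 f A)).
  have b0 : (0 < b)%R by rewrite -lte_fin (le_lt_trans (vnorm_ge0 g A)).
  have [m1 [n1 Wf]] := vnorm_lt fa; have [m2 [n2 Wg]] := vnorm_lt gb.
  pose m := maxn m0 (maxn m1 m2); pose n := maxn n1 n2.
  have Mab0 : (0 <= M * (a + b))%R by rewrite mulr_ge0 ?addr_ge0 ?ltW.
  apply: (@vnorm_le _ _ m n) => //.
  apply: esup0_le; first by rewrite lee_fin powR_ge0.
  move=> _ [P kP <-].
  set F := fun a0 : set X * set X =>
    M%:E * gauge_env S (germ_from l m%:Z) f a0.1.
  set G := fun a0 : set X * set X =>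
    M%:E * gauge_env S (germ_from l m%:Z) g a0.1.
  have F0 i : 0 <= F i by rewrite mule_ge0 ?lee_fin ?gauge_env_ge0.
  have G0 i : 0 <= G i by rewrite mule_ge0 ?lee_fin ?gauge_env_ge0.
  apply: le_trans (_ : \esum_(i in P) ((F i + G i) `^ p) <= _).
    apply: le_esum => -[B B'] PB.
    apply: le_poweR; [exact: ltW|exact: gauge_env_ge0|].
    apply: gauge_env_comb => //= C BC; apply: hM (all_rings_germ _ BC).
      by case: kP => _ _ /(_ _ PB).
    exact: leq_maxl.
  have sumle f' m' n' (a' : R) : (m' <= m)%N -> (n' <= n)%N ->
      packing_sup S p k (germ_from l m'%:Z) f' A n'%:Z <= (a' `^ p)%:E ->
      \esum_(i in P) (gauge_env S (germ_from l m%:Z) f' i.1 `^ p) <=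
        (a' `^ p)%:E.
    move=> mm nn; apply: le_trans; apply: le_trans (esum_gauge_le _ _ _ kP) _.
    by apply: packing_sup_anti => //; exact: ltW.
  rewrite mulrDr; apply: esum_minkowski => //; rewrite ?mulr_gt0//.
  - apply: esum_poweRZ_le => //; [exact: ltW|by move=> i; exact: gauge_env_ge0|].
    apply: sumle Wf; first by rewrite leq_max leq_maxl orbT.
    exact: leq_maxl.
  - apply: esum_poweRZ_le => //; [exact: ltW|by move=> i; exact: gauge_env_ge0|].
    apply: sumle Wg; first by rewrite leq_max leq_maxr orbT.
    exact: leq_maxr.
have real_val f' : vnorm f' A < +oo -> exists c, vnorm f' A = c%:E.
  by move=> fin; exists (fine (vnorm f' A)); rewrite fineK// ge0_fin_numE// vnorm_ge0.
have [a fE] := real_val f ffin; have [b gE] := real_val g gfin.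
rewrite fE gE; apply/lee_addgt0Pr => e e0.
have d0 : (0 < e / (2 * M))%R by rewrite divr_gt0// mulr_gt0.
apply: le_trans (step (a + e / (2 * M))%R (b + e / (2 * M))%R _ _) _.
- by rewrite fE lte_fin ltrDl.
- by rewrite gE lte_fin ltrDl.
rewrite [leRHS](_ : _ = (M * (a + b) + e)%:E)// lee_fin.
rewrite le_eqVlt; apply/orP; left; apply/eqP.
by field; rewrite gt_eqF.
Qed.

Lemma vnorm_cst (c : R[i]) A : vnorm (fun=> c) A = 0.
Proof.
have g0 (l' : Oplus u) B : gauge_env S l' (fun=> c) B = 0.
  apply/eqP; rewrite eq_le gauge_env_ge0 andbT.
  apply: esup0_le => // _ [C _ <-]; apply: esup0_le => // _ [x _ [y _ <-]].
  by rewrite subrr normr0.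
apply/eqP; rewrite eq_le vnorm_ge0 andbT.
apply: (@vnorm_le _ _ 0%N 0%N) => //.
apply: esup0_le; first by rewrite lee_fin powR_ge0.
move=> _ [P _ <-]; rewrite esum1 ?lee_fin ?powR_ge0// => a _.
by rewrite g0 poweR0r// gt_eqF.
Qed.

Lemma packing_sup_mono (k' l' : Oplus u) f A A' n : A `<=` A' ->
  packing_sup S p k' l' f A n <= packing_sup S p k' l' f A' n.
Proof.
move=> AA; apply: le_esup0 => _ [P kP <-]; eexists => //.
by exists P => //; exact: packing_sub kP.
Qed.

Lemma Vvar_mono f A A' : A `<=` A' -> Vvar S p k l f A <= Vvar S p k l f A'.
Proof.
move=> AA; apply: Vvar_ge; first exact: ltW.
move=> m n; apply: le_trans (packing_sup_mono _ _ _ _ AA).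
by apply: Vvar_le; exact: ltW.
Qed.

Lemma vnorm_mono f A A' : A `<=` A' -> vnorm f A <= vnorm f A'.
Proof.
move=> AA; apply: le_poweR; rewrite ?invr_ge0 ?Vvar_ge0 ?(ltW p0)//.
exact: Vvar_mono.
Qed.

Lemma vnormZ (c : R[i]) f A : vnorm f A < +oo ->
  vnorm (fun x => c * f x)%R A = (cmod c)%:E * vnorm f A.
Proof.
move=> ffin.
have le_cmod c' g : vnorm g A < +oo -> c' != 0%R ->
    vnorm (fun x => c' * g x)%R A <= (cmod c')%:E * vnorm g A.
  move=> gfin c'0.
  have := @vnorm_comb g (fun=> 0%R) (fun x => c' * g x)%R A (cmod c').
  rewrite vnorm_cst adde0; apply => //.
    rewrite lt_neqAle cmod_ge0 andbT eq_sym.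
    by apply: contra c'0 => /eqP/cmod_eq0 ->.
  by exists 0%N => B C _ _ x y _ _; rewrite -mulrBr cmodM subrr cmod0 addr0.
have [->|c0] := eqVneq c 0%R.
  have -> : (fun x => 0 * f x)%R = (fun=> 0%R) by apply/funext => x; rewrite mul0r.
  by rewrite vnorm_cst cmod0 mul0e.
apply/eqP; rewrite eq_le le_cmod//=.
have cfin : vnorm (fun x => c * f x)%R A < +oo.
  apply: le_lt_trans (le_cmod _ _ ffin c0) _.
  by rewrite lte_mul_pinfty ?lee_fin ?cmod_ge0.
have := le_cmod (c^-1)%R _ cfin; rewrite invr_eq0 => /(_ c0).
under eq_fun do rewrite mulKf//.
move/(lee_wpmul2l (_ : 0 <= (cmod c)%:E)); rewrite lee_fin => /(_ (cmod_ge0 _)).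
by rewrite muleA -EFinM -cmodM mulfV// /cmod normr1 mul1e.
Qed.
End VariationCalculus.

(** * Comparison of variations under a surjection *)

Section VariationTransfer.
Local Open Scope ereal_scope.
Variables (R : realType) (u : R -> R) (X1 X2 : Type).
Variables (S1 : ball_system X1) (S2 : ball_system X2) (h : X1 -> X2).
Variables (p : R) (k1 l1 k2 l2 : Oplus u) (f : X2 -> R[i]) (K : set X2).
Hypotheses (p1 : (1 <= p)%R) (hsurj : forall y, exists x, h x = y).

Let pullpair (a : set X2 * set X2) := (h @^-1` a.1, h @^-1` a.2).

Let pullpair_inj : {in setT &, injective pullpair}.
Proof.
have hinj (A B : set X2) : h @^-1` A = h @^-1` B -> A = B.
  move=> AB; apply/seteqP; split=> y; have [x <-] := hsurj y => yA.
    by rewrite -[B _]/((h @^-1` B) x) -AB.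
  by rewrite -[A _]/((h @^-1` A) x) AB.
by move=> [A B] [A' B'] _ _ [/hinj-> /hinj->].
Qed.

(** Preimage by a surjection does not decrease oscillations and maps packings
    to packings, so variations compare as soon as rings and outer rings that
    meet K correspond at high levels. *)
Lemma vnorm_transfer :
  (forall m n : nat, exists m' n' : nat,
    (forall a, a.1 `&` K !=set0 -> outer_rings S2 k2 n'%:Z a ->
      outer_rings S1 k1 n%:Z (pullpair a)) /\
    (forall a, a.1 `&` K !=set0 -> all_rings S2 (germ_from l2 m'%:Z) a ->
      all_rings S1 (germ_from l1 m%:Z) (pullpair a))) ->
  vnorm S2 p k2 l2 f K <= vnorm S1 p k1 l1 (f \o h) (h @^-1` K).
Proof.
have p0 : (0 <= p)%R by rewrite (le_trans _ p1).
move=> H; apply: le_poweR; rewrite ?invr_ge0 ?Vvar_ge0//.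
apply: Vvar_ge => // m n; have [m' [n' [outerH ringH]]] := H m n.
apply: le_trans (Vvar_le _ _ _ _ _ m' n' p0) _.
apply: le_esup0 => _ [P [cP oP PK dP] <-].
exists (\esum_(a in pullpair @` P)
  (gauge_env S1 (germ_from l1 m%:Z) (f \o h) a.1 `^ p)).
  exists (pullpair @` P) => //; split.
  - exact: (card_le_trans (card_image_le _ _)).
  - by move=> _ [a Pa <-]; apply: outerH; [exact: PK|exact: oP].
  - move=> _ [a Pa <-]; have [y [ay Ky]] := PK _ Pa.
    by have [x xy] := hsurj y; exists x; split; rewrite /= xy.
  - move=> _ _ [a Pa <-] [b Pb <-] ab; rewrite -preimage_setI dP ?preimage_set0//.
    by move=> eab; apply: ab; rewrite eab.
rewrite (reindex_esum P (pullpair @` P) pullpair); last first.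
  by split=> // a b _ _; apply: pullpair_inj; rewrite in_setT.
apply: le_esum => a Pa; apply: le_poweR => //; first exact: gauge_env_ge0.
apply: le_esup0 => _ [C BC <-].
exists (diam_im (f \o h) (h @^-1` C)).
  by exists (h @^-1` C) => //; exact: (ringH (a.1, C) (PK _ Pa) BC).
apply: le_esup0 => _ [y Cy [z Cz <-]].
have [x xy] := hsurj y; have [t tz] := hsurj z.
eexists => //; exists x; first by rewrite /= xy.
by exists t; rewrite /= ?tz// xy.
Qed.
End VariationTransfer.

(** * The uniform structure defined by the balls *)

Section Sublinearity.
Variables (R : realType) (u : R -> R).
Hypothesis hu : admissible u.

(** Elements of O^+(u) are o(n): acting by one of them still sends balls of
    level tending to infinity to balls of level tending to infinity. *)
Lemma Oplus_sublinear (v : Oplus u) (M : int) :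
  exists N : nat, forall n : int, N%:Z <= n -> M <= n - (ofun v n)%:Z.
Proof.
case: hu => _ _ u0 _.
have [C [vC C0]] := filter_ex (filterI ((eqOP _ _ _).1 (ofunO v))
  (nbhs_pinfty_gt (num_real (0 : R)))).
have e0 : 0 < (C * 2)^-1 by rewrite invr_gt0 mulr_gt0.
have /cvgr0Pnorm_le /(_ _ e0) uC := u0.
have [N1 _ vN] := vC; have [r1 [_ uN]] := uC.
have [N2 N2r] : exists N2 : nat, r1 < N2%:R.
  by exists (Num.bound `|r1|); rewrite (le_lt_trans (ler_norm _))// archi_boundP.
(* From n onwards v n <= C u(n) <= n / 2, hence n - v n >= n / 2 >= |M|. *)
exists (maxn (maxn N1 N2) (`|M| * 2).+1) => -[n|n //]; rewrite lez_nat.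
rewrite !geq_max => /andP[/andP[N1n N2n] Mn].
have n0 : 0 < n%:R :> R by rewrite ltr0n (leq_trans _ Mn).
have vn := vN _ N1n; rewrite /= ger0_norm// in vn.
have un := uN _ (lt_le_trans N2r (_ : _ <= n%:R)); rewrite ler_nat N2n in un.
have {}un := un isT; rewrite normrM normfV (gtr0_norm n0) in un.
rewrite ler_pdivrMr// invfM mulrAC ler_pdivlMr// in un.
have v2n : (ofun v n * 2 <= n)%N.
  rewrite -(ler_nat R) natrM.
  apply: le_trans (ler_wpM2r _ vn) _ => //; rewrite -mulrA.
  apply: le_trans (ler_wpM2l (ltW C0) un) _.
  by rewrite mulVKf ?gt_eqF.
lia.
Qed.

End Sublinearity.

Section Uniformity.
Variables (R : realType) (u : R -> R) (Z : Type) (S : ball_system Z).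
Hypotheses (hu : admissible u) (hS : qs_structure u S).

(** The diagonal is added because a point need not lie in balls of high level
    (it does as soon as Z has two points, by (SC3)). *)
Definition qnear (n : int) (x y : Z) := x = y \/ entourage_lev S n (x, y).

Lemma qnearC n x y : qnear n x y -> qnear n y x.
Proof. by case=> [->|[b nb [/= bx by_]]]; [left|right; exists b]. Qed.

Lemma qnearS m n x y : m <= n -> qnear n x y -> qnear m x y.
Proof. by move=> mn [->|xy]; [left|right; exact: entourage_levS xy]. Qed.

Lemma qnear_ball n b x y : n <= lev S b -> hat S b x -> hat S b y ->
  qnear n x y.
Proof. by right; exists b. Qed.

Lemma hat_oact (v : Oplus u) b : hat S b `<=` hat S (oact v b).
Proof. exact: SC1i hS _ _. Qed.

Lemma lev_oact (v : Oplus u) b : lev S (oact v b) = lev S b - (ofun v (lev S b))%:Z.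
Proof. exact: lev_shift. Qed.

Lemma lev_oact_large (v : Oplus u) (M : int) : exists N : nat, forall b,
  N%:Z <= lev S b -> M <= lev S (oact v b).
Proof.
by have [N NM] := Oplus_sublinear hu v M; exists N => b /NM; rewrite lev_oact.
Qed.

(** This is the triangle axiom of a uniform structure: by (SC2), the ball of
    lower level, shifted by q, contains both balls, and the shift is sublinear
    so that its level is still large. *)
Lemma qnear_comp n : exists2 m, n <= m & forall x y z,
  qnear m x y -> qnear m y z -> qnear n x z.
Proof.
have [q q0 qP] := SC2 hS; have [N NP] := lev_oact_large q n.
exists (Order.max n (Order.max (odom q) N%:Z)); first by rewrite le_max lexx.
have comp b b' x y z : Order.max n (Order.max (odom q) N%:Z) <= lev S b ->
    lev S b <= lev S b' -> hat S b y -> hat S b' y ->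
    hat S b x -> hat S b' z -> hat S (oact q b) x /\ hat S (oact q b) z.
  rewrite !ge_max => /and3P[_ qb _] bb by_ b'y bx b'z.
  split; first exact: hat_oact.
  by apply: (qP b b') => //; exists y.
have ncomp b : Order.max n (Order.max (odom q) N%:Z) <= lev S b ->
    n <= lev S (oact q b) by rewrite !ge_max => /and3P[_ _ /NP].
move=> x y z [->|[b nb [/= bx by_]]].
  by apply: qnearS; rewrite le_max lexx.
case=> [<-|[b' nb' [/= b'y b'z]]].
  by apply: qnear_ball bx by_; apply: le_trans nb; rewrite le_max lexx.
have [bb|/ltW bb] := leP (lev S b) (lev S b').
  by have [? ?] := comp b b' x y z nb bb by_ b'y bx b'z;
    exact: qnear_ball (ncomp _ nb) _ _.
by have [? ?] := comp b' b z y x nb' bb b'y by_ b'z bx;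
  exact: qnear_ball (ncomp _ nb') _ _.
Qed.

(** The triangle axiom is what makes [qnear n x] a neighbourhood, since the
    topology is defined by its open sets. *)
Lemma nbhs_qnearP (x : qs_space S) (A : set (qs_space S)) :
  nbhs x A <-> exists n, forall y, qnear n x y -> A y.
Proof.
rewrite nbhsE; split=> [[B [oB Bx] BA]|[n nA]].
  by have [n nB] := oB _ Bx; exists n => y [<-|/nB]; exact: BA.
exists [set y | exists m, forall z, qnear m y z -> A z] => /=; last first.
  by move=> y [m mA]; apply: mA; left.
split; last by exists n.
move=> y [m mA]; have [m' _ m'P] := qnear_comp m.
exists m' => z yz; exists m' => t zt; apply: mA; apply: m'P zt.
by right.
Qed.

End Uniformity.

(** * Compact sets and functions on a subspace *)

Section Subspace.
Variables (R : realType) (u : R -> R) (Z : Type) (S : ball_system Z).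
Hypotheses (hu : admissible u) (hS : qs_structure u S).
Variable O : set (qs_space S).
Implicit Types (x y : O) (K : set O).

Lemma nbhs_restrP x (A : set O) :
  nbhs x A <-> exists n, forall y, qnear S n (val x) (val y) -> A y.
Proof.
rewrite nbhsE; split=> [[_ [[B oB <-] Bx] BA]|[n nA]].
  have /(nbhs_qnearP hu hS)[n nB] : nbhs (val x : qs_space S) B.
    by apply: open_nbhs_nbhs.
  by exists n => y /nB; exact: BA.
have : nbhs (val x : qs_space S) (qnear S n (val x)).
  by apply/(nbhs_qnearP hu hS); exists n.
rewrite nbhsE => -[B [oB Bx] Bn].
exists (set_val @^-1` B); last by move=> y By; apply: nA; exact: Bn.
by split=> //; exists B.
Qed.

(** Lebesgue number lemma: a level that works near each point of K can be
    chosen uniformly on K. *)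
Lemma compact_qnear K (P : nat -> O -> Prop) : compact K ->
  (forall x, K x -> exists n (N : nat), forall y, qnear S n (val x) (val y) ->
     forall i, (N <= i)%N -> P i y) ->
  exists N : nat, forall i, (N <= i)%N -> forall x, K x -> P i x.
Proof.
move=> /compact_near_coveringP/(_ nat \oo P _) cK KP.
have [|N _ NP] := cK; last by exists N => i /NP.
move=> x /KP[n [N nP]].
exists ([set y | qnear S n (val x) (val y)], [set i | (N <= i)%N]).
  by split; [apply/nbhs_restrP; exists n|exists N].
by move=> [y i] /= [xy Ni]; exact: nP xy i Ni.
Qed.

Lemma compact_qnear_open K : open O -> compact K ->
  exists N : nat, forall x, K x -> forall y : Z, qnear S N%:Z (val x) y -> O y.
Proof.
move=> oO cK.
have [|N NP] := @compact_qnear K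
    (fun i x => forall y : Z, qnear S i%:Z (val x) y -> O y) cK.
  move=> x Kx; have Ox : O (val x) by exact: set_valP.
  have /(nbhs_qnearP hu hS)[n nO] : nbhs (val x : qs_space S) O.
    exact: open_nbhs_nbhs.
  have [m nm mP] := qnear_comp hu hS n.
  exists m, `|m|%N => y xy i mi z yz; apply: nO; apply: mP xy _.
  by apply: qnearS yz; lia.
by exists N => x Kx; exact: NP.
Qed.

Lemma continuousC_near (X : topologicalType) (f : X -> R[i]) (x : X) :
  continuousC f -> \forall y \near x, cmod (f y) <= cmod (f x) + 1.
Proof.
move=> /(_ x)/cvgrPdist_lt/(_ 1 ltr01); apply: filterS => y.
rewrite cmodE -[1]/(1%:C%C) ltcR => fxy.
rewrite -[f y](subrK (f x)) addrC [leRHS]addrC; apply: le_trans (cmodD _ _) _.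
rewrite [leRHS]addrC lerD2l ltW//; move: fxy; rewrite /cmod -normrN opprB.
by [].
Qed.

(** Products need bounds not only on K but on the outer sets of the rings that
    meet K. *)
Lemma compact_qnear_bounded K (f : O -> R[i]) : continuousC f -> compact K ->
  exists N : nat, forall x, K x -> forall y, qnear S N%:Z (val x) (val y) ->
    cmod (f y) <= N%:R.
Proof.
move=> cf cK.
have [|N NP] := @compact_qnear K (fun i x => forall y,
    qnear S i%:Z (val x) (val y) -> cmod (f y) <= i%:R) cK.
  move=> x Kx.
  have /nbhs_restrP[n nf] := continuousC_near x cf.
  have [m nm mP] := qnear_comp hu hS n.
  exists m, (`|m| + Num.bound (cmod (f x) + 1))%N => y xy i mi z yz.
  have /le_trans -> // : cmod (f z) <= cmod (f x) + 1.
    by apply: nf; apply: mP xy _; apply: qnearS yz; lia.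
  have fx0 : 0 <= cmod (f x) + 1 by rewrite addr_ge0 ?cmod_ge0.
  rewrite (le_trans (ltW (archi_boundP fx0)))// ler_nat.
  by apply: leq_trans mi; rewrite leq_addl.
by exists N => x Kx; exact: NP.
Qed.

Lemma ball_near_compact (l : Oplus u) (N : nat) : exists m : nat,
  forall b x (z : Z), m%:Z <= lev S b -> hat S (oact l b) (val x) ->
    hat S (oact l b) z -> qnear S N%:Z (val x) z.
Proof.
have [m mP] := lev_oact_large S hu l N%:Z.
by exists m => b x z mb xb zb; apply: qnear_ball xb zb; exact: mP.
Qed.

(** The outer set of a ring lies in a shift l.b that meets K with its inner
    set, and the level of l.b is large if that of b is. *)
Lemma restr_ring_near (l : Oplus u) (N : nat) : exists m : nat,
  forall (K : set O) B C, B `&` K !=set0 ->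
    all_rings (restr_system S O) (germ_from l m%:Z) (B, C) ->
    exists2 x, K x & forall y, C y -> qnear S N%:Z (val x) (val y).
Proof.
have [m mP] := ball_near_compact l N; exists m => K B C [x [Bx Kx]].
move=> [n _ [[b Ob] [_ /= mb bB BC Cb]]]; exists x => // y Cy.
apply: (mP b).
- by apply: le_trans mb; rewrite le_max lexx orbT.
- by apply: Cb; exact: BC.
- exact: Cb.
Qed.

End Subspace.

(** * The algebra of functions of locally bounded variation *)

Section FunctionSpace.
Variables (R : realType) (u : R -> R) (Z : Type) (S : ball_system Z).
Hypotheses (hu : admissible u) (hS : qs_structure u S).
Variables (O : set (qs_space S)) (p : R) (k l : Oplus u).
Hypothesis p1 : 1 <= p.
Local Notation V := (Vloc (restr_system S O) p k l).
Local Notation vn := (vnorm (restr_system S O) p k l).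

Lemma VlocP f : V f <-> continuousC f /\
  forall K : set O, compact K -> (vn f K < +oo)%E.
Proof.
by split=> -[cf fK]; split=> // K /fK; rewrite vnorm_lty.
Qed.

Lemma continuousC_add (X : topologicalType) (f g : X -> R[i]) :
  continuousC f -> continuousC g -> continuousC (fun x => f x + g x).
Proof. by move=> cf cg x; apply: cvgD; [exact: cf|exact: cg]. Qed.

Lemma continuousC_mul (X : topologicalType) (f g : X -> R[i]) :
  continuousC f -> continuousC g -> continuousC (fun x => f x * g x).
Proof. by move=> cf cg x; apply: cvgM; [exact: cf|exact: cg]. Qed.

Lemma continuousC_cst (X : topologicalType) (c : R[i]) :
  continuousC (fun _ : X => c).
Proof. by move=> x; exact: cvg_cst. Qed.

Lemma vnormD f g (K : set O) : (vn f K < +oo)%E -> (vn g K < +oo)%E ->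
  (vn (fun x => (f x + g x)%R) K <= vn f K + vn g K)%E.
Proof.
move=> fK gK; rewrite -[leRHS]mul1e; apply: vnorm_comb => //.
exists 0%N => B C _ _ x y _ _.
by rewrite mul1r opprD addrACA cmodD.
Qed.

Lemma Vloc_add f g : V f -> V g -> V (fun x => f x + g x).
Proof.
move=> /VlocP[cf fK] /VlocP[cg gK]; apply/VlocP; split.
  exact: continuousC_add.
by move=> K cK; apply: le_lt_trans (vnormD (fK _ cK) (gK _ cK)) _;
  apply: lte_add_pinfty; [exact: fK|exact: gK].
Qed.

Lemma Vloc_scale (c : R[i]) f : V f -> V (fun x => c * f x).
Proof.
move=> /VlocP[cf fK]; apply/VlocP; split.
  exact: (continuousC_mul (@continuousC_cst _ c) cf).
move=> K cK; rewrite (vnormZ p1 _ (fK _ cK)).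
by apply: lte_mul_pinfty; rewrite ?lee_fin ?cmod_ge0//; exact: fK.
Qed.

Lemma Vloc_mul f g : V f -> V g -> V (fun x => f x * g x).
Proof.
move=> /VlocP[cf fK] /VlocP[cg gK]; apply/VlocP; split.
  exact: continuousC_mul.
move=> K cK.
have [N1 fN] := compact_qnear_bounded hu hS cf cK.
have [N2 gN] := compact_qnear_bounded hu hS cg cK.
have [m mP] := restr_ring_near hu O l (maxn N1 N2).
(* The successor only serves to have 0 < M. *)
pose M : R := (maxn N1 N2).+1%:R.
have : (vn (fun x => f x * g x)%R K <= M%:E * (vn f K + vn g K))%E.
  apply: vnorm_comb => //; [|exact: fK|exact: gK].
  exists m => B C BK /(mP K _ _ BK)[x Kx Cx] y z Cy Cz.
  have fM : cmod (f y) <= M.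
    apply: le_trans (fN x Kx y _) _; last by rewrite ler_nat leqW// leq_maxl.
    by apply: qnearS (Cx _ Cy); rewrite lez_nat leq_maxl.
  have gM : cmod (g z) <= M.
    apply: le_trans (gN x Kx z _) _; last by rewrite ler_nat leqW// leq_maxr.
    by apply: qnearS (Cx _ Cz); rewrite lez_nat leq_maxr.
  have -> : f y * g y - f z * g z = f y * (g y - g z) + g z * (f y - f z).
    by ring.
  apply: le_trans (cmodD _ _) _; rewrite !cmodM mulrDr addrC.
  by apply: lerD; apply: ler_wpM2r; rewrite ?cmod_ge0.
move=> /le_lt_trans; apply; apply: lte_mul_pinfty; rewrite ?lee_fin ?ler0n//.
by apply: lte_add_pinfty; [exact: fK|exact: gK].
Qed.

Lemma Vloc_subalgebra : unital_subalgebra V.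
Proof.
split; [|exact: Vloc_add|exact: Vloc_mul|by move=> c f; exact: Vloc_scale].
apply/VlocP; split; first exact: continuousC_cst.
by move=> K _; rewrite vnorm_cst.
Qed.

Definition supnorm (X : Type) (f : X -> R[i]) (K : set X) : \bar R :=
  esup0 [set (cmod (f x))%:E | x in K].

Lemma VnormE (K : set O) f :
  Vnorm (restr_system S O) p k l K f = (supnorm f K + vn f K)%E.
Proof. by []. Qed.

Lemma supnormD (X : Type) (f g : X -> R[i]) (K : set X) :
  (supnorm (fun x => (f x + g x)%R) K <= supnorm f K + supnorm g K)%E.
Proof.
apply: esup0_le => [|_ [x Kx <-]]; first by rewrite adde_ge0 ?esup0_ge0.
apply: le_trans (_ : (cmod (f x) + cmod (g x))%:E <= _)%E.
  by rewrite lee_fin cmodD.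
by rewrite EFinD; apply: leeD; apply: esup0_ubound; exists x.
Qed.

Lemma supnormZ (X : Type) (c : R[i]) (f : X -> R[i]) (K : set X) :
  supnorm (fun x => c * f x) K = ((cmod c)%:E * supnorm f K)%E.
Proof.
have le_c d (g : X -> R[i]) :
    (supnorm (fun x => d * g x)%R K <= (cmod d)%:E * supnorm g K)%E.
  apply: esup0_le => [|_ [x Kx <-]].
    by rewrite mule_ge0 ?esup0_ge0 ?lee_fin ?cmod_ge0.
  rewrite cmodM EFinM; apply: lee_wpmul2l; first by rewrite lee_fin cmod_ge0.
  by apply: esup0_ubound; exists x.
apply/eqP; rewrite eq_le le_c /=.
have [->|c0] := eqVneq c 0; first by rewrite cmod0 mul0e esup0_ge0.
have := le_c c^-1 (fun x => c * f x).
under eq_fun do rewrite mulKf//.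
move/(lee_wpmul2l (_ : 0 <= (cmod c)%:E)%E); rewrite lee_fin => /(_ (cmod_ge0 _)).
by rewrite muleA -EFinM -cmodM mulfV// /cmod normr1 mul1e.
Qed.

Lemma supnorm_lty f (K : set O) : continuousC f -> compact K ->
  (supnorm f K < +oo)%E.
Proof.
move=> cf cK; have [N fN] := compact_qnear_bounded hu hS cf cK.
apply: le_lt_trans (_ : N%:R%:E < +oo)%E; last exact: ltry.
apply: esup0_le => [|_ [x Kx <-]]; first by rewrite lee_fin.
by rewrite lee_fin; apply: (fN x) => //; left.
Qed.

Lemma Vnorm_seminorm (K : set O) : compact K ->
  seminorm_on V (Vnorm (restr_system S O) p k l K).
Proof.
move=> cK; split.
- move=> f /VlocP[cf fK]; rewrite VnormE adde_ge0 ?esup0_ge0 ?vnorm_ge0//=.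
  by apply: lte_add_pinfty; [exact: supnorm_lty|exact: fK].
- move=> f g /VlocP[cf fK] /VlocP[cg gK]; rewrite !VnormE addeACA.
  by apply: leeD; [exact: supnormD|apply: vnormD; [exact: fK|exact: gK]].
- move=> c f /VlocP[cf fK]; rewrite !VnormE supnormZ (vnormZ p1 _ (fK _ cK)).
  by rewrite ge0_muleDr ?esup0_ge0 ?vnorm_ge0.
Qed.

Lemma Vnorm_mono (K K' : set O) f : K `<=` K' ->
  (Vnorm (restr_system S O) p k l K f <= Vnorm (restr_system S O) p k l K' f)%E.
Proof.
move=> KK; rewrite !VnormE; apply: leeD; last exact: vnorm_mono.
by apply: le_esup0 => _ [x Kx <-]; eexists => //; exists x => //; exact: KK.
Qed.
End FunctionSpace.

(** * Countable families of seminorms *)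

Section Exhaustion.
Variables (R : realType) (u : R -> R) (Z : Type) (S : ball_system Z).
Hypotheses (hu : admissible u) (hS : qs_structure u S).
Variable O : set (qs_space S).
Hypotheses (oO : open O) (hlc : locally_compact [set: qs_space S])
  (hsc : @second_countable (qs_space S)).

Lemma compact_restr (C : set (qs_space S)) : C `<=` O -> compact C ->
  compact (set_val @^-1` C : set O).
Proof.
move=> CO cC F FF FC.
have [z [Cz zF]] := cC (set_val @ F) _ FC.
exists (exist _ z (mem_set (CO _ Cz)) : O); split; first by rewrite /= set_valE.
move=> A W FA /(nbhs_restrP hu hS)[n nW].
have [] := zF (set_val @` A) (qnear S n z).
- by apply: (filterS (P := A)) FA => y Ay; exists y.
- by apply/(nbhs_qnearP hu hS); exists n.
by move=> _ [[y Ay <-] zy]; exists y; split=> //; apply: nW.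
Qed.

(** Local compactness of an open subset: no separation axiom is assumed, but
    uniformity makes closures of small balls small. *)
Lemma locally_compact_restr (x : O) : exists2 C : set O, compact C & nbhs x C.
Proof.
have [U Ux [cU clU]] := @hlc (val x) I.
have {Ux} Ux : nbhs (val x : qs_space S) U.
  by move: Ux; rewrite /= /within /=; apply: filterS => y /(_ Logic.I).
have Ox : nbhs (val x : qs_space S) O.
  by apply: open_nbhs_nbhs; split=> //; exact: set_valP.
have OU : nbhs (val x : qs_space S) (O `&` U) by exact: filterI.
have /(nbhs_qnearP hu hS)[n nOU] := OU.
have [m nm mP] := qnear_comp hu hS n.
pose E : set (qs_space S) := qnear S m (val x).
pose C : set (qs_space S) := closure E.
have COU y : C y -> O y /\ U y.
  move=> /(_ (qnear S m y))[|z [xz yz]].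
    by apply/(nbhs_qnearP hu hS); exists m.
  by apply: nOU; apply: mP xz _; exact: qnearC.
exists (set_val @^-1` C).
  apply: compact_restr; first by move=> y /COU[].
  apply: subclosed_compact cU _; first exact: closed_closure.
  by move=> y /COU[].
apply/(nbhs_restrP hu hS); exists m => y xy.
exact: subset_closure.
Qed.

(** Each basic open set that lies in some compact subset of O is assigned one
    such subset. Their interiors cover O by local compactness, so every compact
    set is covered by finitely many of them. *)
Lemma compact_exhaustion : exists C : nat -> set O,
  (forall n, compact (C n)) /\
  forall K : set O, compact K -> exists n, K `<=` C n.
Proof.
have [B /countable_injP[e einj] [Bo Bb]] := hsc.
have /choice[C CP] : forall n, exists C : set O, compact C /\
    forall U, B U -> e U = n ->
    (exists2 C' : set O, compact C' & set_val @^-1` U `<=` C') ->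
    set_val @^-1` U `<=` C.
  move=> n; have [[U [BU Un [C cC UC]]]|none] := pselect (exists U,
      [/\ B U, e U = n & exists2 C' : set O, compact C' &
          set_val @^-1` U `<=` C']).
    exists C; split=> // U' BU' U'n _; suff -> : U' = U by [].
    by apply: einj; rewrite ?inE// Un.
  exists set0; split; first exact: compact0.
  by move=> U BU Un UC; case: none; exists U.
exists (fun n => \big[setU/set0]_(i < n) C i); split.
  by move=> n; apply: bigsetU_compact => i _; case: (CP i).
move=> K cK.
have [|N NP] := @compact_qnear _ _ _ _ hu hS O K
    (fun i x => (\big[setU/set0]_(j < i) C j) x) cK.
  move=> x Kx; have [D cD xD] := locally_compact_restr x.
  have /(nbhs_restrP hu hS)[n nD] := xD.
  have xn : nbhs (val x : qs_space S) (qnear S n (val x)).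
    by apply/(nbhs_qnearP hu hS); exists n.
  have [U [BU Ux] Un] := Bb (val x) _ xn.
  have UC : set_val @^-1` U `<=` C (e U).
    by apply: (CP (e U)).2 => //; exists D => // y Uy; apply: nD; exact: Un.
  have /(nbhs_qnearP hu hS)[m mU] : nbhs (val x : qs_space S) U.
    by apply: open_nbhs_nbhs; split=> //; exact: Bo.
  exists m, (e U).+1 => y xy i ei.
  rewrite (bigD1 (Ordinal ei))//=; left; apply: UC; exact: mU.
by exists N => x Kx; exact: NP.
Qed.
End Exhaustion.

(** Stated for rewriting: unfolding the structure of topological space inside a
    goal exposes its whole construction. *)
Lemma seminorm_openP (R : realType) (X I : Type) (V : set (X -> R[i]))
    (N : I -> (X -> R[i]) -> \bar R) (U : set V) :
  @open (seminorm_space V N) U <-> seminorm_open N U.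
Proof. by []. Qed.

Section CountableSeminorms.
Variables (R : realType) (u : R -> R) (Z : Type) (S : ball_system Z).
Hypotheses (hu : admissible u) (hS : qs_structure u S).
Variable O : set (qs_space S).
Variables (p : R) (k l : Oplus u).
Hypotheses (p1 : 1 <= p) (oO : open O)
  (hlc : locally_compact [set: qs_space S])
  (hsc : @second_countable (qs_space S)).

Lemma Vloc_countably_seminormed :
  countably_seminormed (Vloc (restr_system S O) p k l)
    (fun K : {K : set O | compact K} => Vnorm (restr_system S O) p k l (sval K)).
Proof.
have [C [cC CK]] := compact_exhaustion hu hS oO hlc hsc.
exists (fun n => Vnorm (restr_system S O) p k l (C n)).
  by move=> n; exact: Vnorm_seminorm.
have /choice[nu nuP] : forall K : {K : set O | compact K}, exists n,
    sval K `<=` C n by move=> [K cK]; exact: CK.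
move=> U; split=> /seminorm_openP oU; apply/seminorm_openP => f Uf;
  have [D fD [e e0 DU]] := oU f Uf.
- exists (nu @` D); first exact: finite_image.
  exists e => // g gD; apply: DU => K DK.
  apply: le_lt_trans (gD (nu K) _); last by exists K.
  by apply: Vnorm_mono => //; exact: nuP.
- exists ((fun n => exist _ (C n) (cC n)) @` D); first exact: finite_image.
  exists e => // g gD; apply: DU => n Dn.
  by apply: (gD (exist _ (C n) (cC n))); exists n.
Qed.
End CountableSeminorms.

(** * Transfer of rings along a bijection *)

(** Control of rings read through a map h, so that the two directions of a
    quasisymmetric homeomorphism become instances of one notion. *)
Definition ring_transfer (R : realType) (u : R -> R) (Z1 Z2 : Type)
    (S1 : ball_system Z1) (S2 : ball_system Z2) (h : Z1 -> Z2)
    (eta etab : Oplus u -> Oplus u) : Prop :=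
  exists lam : R, exists n0 : int, 0 < lam /\
    forall (k j : Oplus u) (n : int), n0 <= n -> forall a,
      (rings S2 k n a -> rings S1 (eta k) (Num.floor (lam * n%:~R))
         (h @^-1` a.1, h @^-1` a.2)) /\
      (outer_rings S2 (etab j) n a ->
         outer_rings S1 j (Num.floor (lam * n%:~R)) (h @^-1` a.1, h @^-1` a.2)).

Lemma floor_scale_large (R : realType) (lam : R) (n0 M : int) : 0 < lam ->
  exists N : nat, forall n : nat, (N <= n)%N ->
    n0 <= n%:Z /\ M <= Num.floor (lam * n%:~R).
Proof.
move=> lam0; pose r : R := `|M%:~R| / lam.
exists (maxn `|n0|%N (Num.bound r)) => n; rewrite geq_max => /andP[n0n rn].
split; first lia.
rewrite floor_ge_int; apply: le_trans (ler_norm _) _.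
rewrite -ler_pdivrMl// mulrC.
have r0 : 0 <= r by rewrite divr_ge0// ltW.
by apply: le_trans (ltW (archi_boundP r0)) _; rewrite ler_nat.
Qed.

Section Transfer.
Variables (R : realType) (u : R -> R) (Z1 Z2 : Type).
Variables (S1 : ball_system Z1) (S2 : ball_system Z2).
Variables (h : qs_space S1 -> qs_space S2) (g : qs_space S2 -> qs_space S1).
Variables (eta etab : Oplus u -> Oplus u).
Hypotheses (hu : admissible u) (hS1 : qs_structure u S1)
  (hS2 : qs_structure u S2).
Hypotheses (hK : cancel h g) (gK : cancel g h).
Hypothesis T : ring_transfer S1 S2 h eta etab.

(** A ring is trapped between hat b and hat (k.b), so transferring this one
    pair transfers every ring that b carries. *)
Lemma transfer_ball (k : Oplus u) (N : int) : exists m : nat, forall b,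
  m%:Z <= lev S2 b -> odom k <= lev S2 b -> exists b1,
  [/\ N <= lev S1 b1, odom (eta k) <= lev S1 b1,
      hat S1 b1 `<=` h @^-1` hat S2 b &
      h @^-1` hat S2 (oact k b) `<=` hat S1 (oact (eta k) b1)].
Proof.
have [lam [n0 [lam0 TP]]] := T.
have [m mP] := floor_scale_large n0 N lam0.
exists m => b mb kb; have [n0m Nm] := mP m (leqnn m).
have [|b1 [mb1 eb1 b1b _ bb1]] := (TP k k m n0m (hat S2 b, hat S2 (oact k b))).1.
  by exists b; split => //=; exact: hat_oact.
by exists b1; split => //; exact: le_trans mb1.
Qed.

Lemma transfer_outer_ball (k : Oplus u) (N : int) : exists m : nat, forall b,
  m%:Z <= lev S2 b -> odom (etab k) <= lev S2 b -> exists b1,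
  [/\ N <= lev S1 b1, odom k <= lev S1 b1,
      h @^-1` hat S2 b `<=` hat S1 b1 &
      hat S1 (oact k b1) `<=` h @^-1` hat S2 (oact (etab k) b)].
Proof.
have [lam [n0 [lam0 TP]]] := T.
have [m mP] := floor_scale_large n0 N lam0.
exists m => b mb kb; have [n0m Nm] := mP m (leqnn m).
have [|b1 [mb1 eb1 b1b _ bb1]] :=
    (TP k k m n0m (hat S2 b, hat S2 (oact (etab k) b))).2.
  by exists b; split => //=; exact: hat_oact.
by exists b1; split => //; exact: le_trans mb1.
Qed.

(** The pair (hat b, hat b) is squeezed into a ring, so its preimage is
    contained in a ball of high level. *)
Lemma transfer_qnear (k : Oplus u) n : exists m, forall x y,
  qnear S2 m x y -> qnear S1 n (g x) (g y).
Proof.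
have [N NP] := lev_oact_large S1 hu (eta k) n.
have [m mP] := transfer_ball k N%:Z.
exists (Order.max (odom k) m%:Z) => x y [->|[b]]; first by left.
rewrite /= ge_max => /andP[kb mb] [bx by_].
have [b1 [Nb1 _ _ bb1]] := mP b mb kb.
by apply: (qnear_ball (NP _ Nb1)); apply: bb1; rewrite /= gK; exact: (hat_oact hS2).
Qed.

Lemma transfer_continuous (k : Oplus u) : continuous g.
Proof.
move=> x A /(nbhs_qnearP hu hS1)[n nA].
have [m mP] := transfer_qnear k n.
by apply/(nbhs_qnearP hu hS2); exists m => y /mP/nA.
Qed.

Variables (O1 : set (qs_space S1)) (O2 : set (qs_space S2)).
Hypothesis oO2 : open O2.
Variable hr : O1 -> O2.
Hypotheses (hrE : forall x, val (hr x) = h (val x))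
  (hr_surj : forall y, exists x, hr x = y).

Lemma restr_inverse : exists gr : O2 -> O1,
  (forall y, hr (gr y) = y) /\ forall y, val (gr y) = g (val y).
Proof.
have /choice[gr grK] := hr_surj; exists gr; split=> // y.
by rewrite -[in RHS](grK y) hrE hK.
Qed.

Lemma restr_inverse_continuous (k : Oplus u) (gr : O2 -> O1) :
  (forall y, val (gr y) = g (val y)) -> continuous gr.
Proof.
move=> grE x A /(nbhs_restrP hu hS1)[n nA].
have [m mP] := transfer_qnear k n.
apply/(nbhs_restrP hu hS2); exists m => y /mP xy.
by apply: nA; rewrite !grE.
Qed.

Lemma transfer_compact (k : Oplus u) (K : set O2) :
  compact K -> compact (hr @^-1` K).
Proof.
move=> cK; have [gr [grK grE]] := restr_inverse.
rewrite (_ : hr @^-1` K = gr @` K).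
  apply: continuous_compact cK; apply: continuous_subspaceT.
  exact: restr_inverse_continuous grE.
apply/seteqP; split=> [x Kx|_ [y Ky <-]]; last by rewrite /= grK.
by exists (hr x) => //; apply: val_inj; rewrite grE hrE hK.
Qed.

Lemma transfer_O1 x : O2 (h x) -> O1 x.
Proof.
move=> O2x; have [y yx] := hr_surj (exist _ (h x) (mem_set O2x)).
have <- : val y = x by rewrite -[LHS]hK -hrE yx /= hK.
exact: set_valP.
Qed.

Variables (p : R) (k1 l2 : Oplus u).
Hypothesis p1 : 1 <= p.
Local Notation S1r := (restr_system S1 O1).
Local Notation S2r := (restr_system S2 O2).

Lemma hat_shift_sub (b : ball_of S1) j : hat S1 b `<=` hat S1 (bshift S1 j b).
Proof. exact: (SC1i hS1). Qed.

(** The transferred ball b1 must be shown to belong to the structure restricted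
    to O1, that is, to meet O1 together with all its shifts. For an outer ring
    a point of the inner set provides this. For a ring, b1 is contained in the
    preimage of hat b, and hat b lies inside O2 because l2.b meets K at high
    level. *)
Lemma transfer_restr_rings (K : set O2) (m n : nat) : compact K ->
  exists m' n' : nat,
    (forall a, a.1 `&` K !=set0 -> outer_rings S2r (etab k1) n'%:Z a ->
      outer_rings S1r k1 n%:Z (hr @^-1` a.1, hr @^-1` a.2)) /\
    (forall a, a.1 `&` K !=set0 -> all_rings S2r (germ_from l2 m'%:Z) a ->
      all_rings S1r (germ_from (eta l2) m%:Z) (hr @^-1` a.1, hr @^-1` a.2)).
Proof.
move=> cK.
have [N NP] := compact_qnear_open hu hS2 oO2 cK.
have [m0 m0P] := ball_near_compact hu O2 l2 N.
have [m' m'P] := transfer_ball l2 m%:Z.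
have [n' n'P] := transfer_outer_ball k1 n%:Z.
exists (maxn m0 m'), n'; split.
  move=> [a1 a2] /= [x [ax Kx]] [[b Ob] /= [n'b kb ab _ ba]].
  have [b1 [nb1 k1b1 bb1 b1b]] := n'P b n'b kb.
  have [x1 x1x] := hr_surj x.
  have b1x1 : hat S1 b1 (val x1).
    by apply: bb1; rewrite /= -hrE x1x; exact: (ab x ax).
  have Ob1 j : hat S1 (bshift S1 j b1) `&` O1 !=set0.
    by exists (val x1); split; [exact: hat_shift_sub|exact: set_valP].
  exists (exist _ b1 Ob1); split => //= y.
  - by move=> ay; apply: bb1; rewrite /= -hrE; exact: ab.
  - exact: (hat_oact hS1).
  - by move=> b1y; apply: ba; rewrite /= set_valE/= hrE; exact: b1b.
move=> [B C] /= [x [Bx Kx]] [i /= _ [[b Ob] /= [_]]].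
rewrite ge_max => /andP[lb mb] bB BC Cb.
have [m0b m'b] : m0%:Z <= lev S2 b /\ m'%:Z <= lev S2 b.
  by move: mb; lia.
have [b1 [mb1 lb1 b1b bb1]] := m'P b m'b lb.
have bO2 : hat S2 b `<=` O2.
  move=> z bz; apply: (NP x Kx); apply: (m0P b) => //.
    by apply: Cb; exact: BC.
  exact: (hat_oact hS2).
have [w b1w] := hat_neq0 hS1 b1.
have Ob1 j : hat S1 (bshift S1 j b1) `&` O1 !=set0.
  exists w; split; first exact: hat_shift_sub.
  by apply: transfer_O1; apply: bO2; exact: b1b.
exists (odom (germ_from (eta l2) m%:Z)) => //=.
have levb1 : Order.max (odom (eta l2)) m%:Z <= lev S1 b1 by rewrite ge_max lb1.
exists (exist _ b1 Ob1); split => //= y.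
- by move=> b1y; apply: bB; rewrite /= set_valE/= hrE; exact: b1b.
- exact: BC.
- by move=> Cy; apply: bb1; rewrite /= -hrE; exact: Cb.
Qed.

Lemma transfer_Vnorm (K : set O2) (f : O2 -> R[i]) : compact K ->
  (vnorm S2r p (etab k1) l2 f K <=
     vnorm S1r p k1 (eta l2) (f \o hr) (hr @^-1` K))%E /\
  (Vnorm S2r p (etab k1) l2 K f <=
     Vnorm S1r p k1 (eta l2) (hr @^-1` K) (f \o hr))%E.
Proof.
move=> cK.
have vle : (vnorm S2r p (etab k1) l2 f K <=
     vnorm S1r p k1 (eta l2) (f \o hr) (hr @^-1` K))%E.
  by apply: vnorm_transfer => // m n; exact: transfer_restr_rings.
split=> //; rewrite !VnormE; apply: leeD => //.
apply: le_esup0 => _ [y Ky <-]; have [x xy] := hr_surj y.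
by eexists => //; exists x; rewrite /= xy.
Qed.

Lemma transfer_Vloc (f : O2 -> R[i]) :
  Vloc S1r p k1 (eta l2) (f \o hr) -> Vloc S2r p (etab k1) l2 f.
Proof.
move=> /(VlocP _ _ p1)[cf fK]; apply/(VlocP _ _ p1); split.
  have [gr [grK grE]] := restr_inverse.
  have -> : f = (f \o hr) \o gr by apply/funext => y; rewrite /= grK.
  move=> y; apply: continuous_comp; last exact: cf.
  exact: (restr_inverse_continuous k1 grE).
move=> K cK; apply: le_lt_trans (transfer_Vnorm f cK).1 _.
by apply: fK; exact: (transfer_compact k1).
Qed.

End Transfer.

(** * Inclusions of function spaces *)

Section Inclusions.
Variables (R : realType).

Lemma algebra_hom_incl (X : Type) (V W : set (X -> R[i])) (i : V -> W) :
  unital_subalgebra V -> unital_subalgebra W ->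
  (forall f, val (i f) = val f) -> algebra_hom i.
Proof.
move=> aV aW iE; split=> //; split.
- by move=> f f1; rewrite iE.
- by move=> c f g h hE; rewrite !iE.
- by move=> f g h hE; rewrite !iE.
Qed.

Lemma pullback_subalgebra (X Y : Type) (psi : X -> Y) (V : set (Y -> R[i])) :
  unital_subalgebra V -> unital_subalgebra (pullback_funs psi V).
Proof.
case=> V1 VD VM VZ; split.
- by exists (fun=> 1).
- by move=> _ _ [f Vf <-] [g Vg <-]; exists (fun x => f x + g x) => //; exact: VD.
- by move=> _ _ [f Vf <-] [g Vg <-]; exists (fun x => f x * g x) => //; exact: VM.
- by move=> c _ [f Vf <-]; exists (fun x => c * f x) => //; exact: VZ.
Qed.

Variables (u : R -> R) (Z1 Z2 : Type).
Variables (S1 : ball_system Z1) (S2 : ball_system Z2).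
Variables (h : qs_space S1 -> qs_space S2) (g : qs_space S2 -> qs_space S1).
Variables (eta etab : Oplus u -> Oplus u).
Hypotheses (hu : admissible u) (hS1 : qs_structure u S1)
  (hS2 : qs_structure u S2).
Hypotheses (hK : cancel h g) (gK : cancel g h).
Hypothesis T : ring_transfer S1 S2 h eta etab.
Variables (O1 : set (qs_space S1)) (O2 : set (qs_space S2)).
Hypothesis oO2 : open O2.
Variables (hr : O1 -> O2) (gr : O2 -> O1).
Hypotheses (hrE : forall x, val (hr x) = h (val x))
  (hrK : cancel hr gr) (grK : cancel gr hr).
Variables (p : R) (k l : Oplus u).
Hypothesis p1 : 1 <= p.
Local Notation S1r := (restr_system S1 O1).
Local Notation S2r := (restr_system S2 O2).
Local Notation V1 := (Vloc S1r p k (eta l)).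
Local Notation V2 := (Vloc S2r p (etab k) l).

Let hr_surj y : exists x, hr x = y. Proof. by exists (gr y). Qed.

Let preim (K : {K : set O2 | compact K}) : {K : set O1 | compact K} :=
  exist _ (hr @^-1` sval K)
    (transfer_compact hu hS1 hS2 hK gK T hrE hr_surj k (svalP K)).

Let V2_of f : V1 (f \o hr) -> V2 f.
Proof. exact: (transfer_Vloc hu hS1 hS2 hK gK T). Qed.

Let Vnorm2_le K f : (Vnorm S2r p (etab k) l (sval K) f <=
  Vnorm S1r p k (eta l) (sval (preim K)) (f \o hr))%E.
Proof. by apply: (transfer_Vnorm hu hS1 hS2 hK T oO2 hrE hr_surj _ _ p1 _ (svalP K)).2. Qed.

(** A neighbourhood of f given by the compact sets K in D is controlled by the
    one given by their preimages, with the same radius, because each norm on O2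
    is bounded by the norm on the preimage. *)
Lemma inclusion_to_pullback :
  exists i : Vspace S1r p k (eta l) ->
             pullback_Vspace hr S2r p (etab k) l,
    [/\ forall f, val (i f) = val f, algebra_hom i & continuous i].
Proof.
have imV f : V1 f -> pullback_funs hr V2 f.
  have fE : (f \o gr) \o hr = f by apply/funext => x /=; rewrite hrK.
  by move=> Vf; exists (f \o gr) => //; apply: V2_of; rewrite fE.
pose i (f : Vspace S1r p k (eta l)) : pullback_Vspace hr S2r p (etab k) l :=
  exist _ (val f) (mem_set (imV _ (set_valP f))).
have iE f : val (i f) = val f by [].
exists i; split; first exact: iE.
  apply: algebra_hom_incl; [exact: Vloc_subalgebra| |exact: iE].
  by apply: pullback_subalgebra; exact: Vloc_subalgebra.
apply/continuousP => U oU; apply/seminorm_openP => f Uif.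
have [f2 V2f2 f2E] := imV _ (set_valP f).
pose f2' : V2 := exist _ f2 (mem_set V2f2).
have if2 : pullback_map hr f2' = i f by apply: val_inj => /=.
have /seminorm_openP oU' := oU.
have [|D fD [e e0 DU]] := oU' f2'; first by rewrite /= if2.
exists (preim @` D); first exact: finite_image.
exists e => // g1 g1D.
have [g2 V2g2 g2E] := imV _ (set_valP g1).
pose g2' : V2 := exist _ g2 (mem_set V2g2).
have ig2 : pullback_map hr g2' = i g1 by apply: val_inj => /=.
rewrite /= -ig2; apply: (DU g2') => K DK.
apply: le_lt_trans (Vnorm2_le _ _) _.
have := g1D (preim K) (ex_intro2 _ _ K DK erefl).
by rewrite -g2E -f2E.
Qed.

Lemma inclusion_from_pullback :
  exists j : pullback_Vspace gr S1r p k (eta l) -> Vspace S2r p (etab k) l,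
    [/\ forall f, val (j f) = val f, algebra_hom j & continuous j].
Proof.
have imV f : pullback_funs gr V1 f -> V2 f.
  move=> [f1 V1f1 <-]; apply: V2_of.
  by have -> : (f1 \o gr) \o hr = f1 by apply/funext => x /=; rewrite hrK.
pose j (f : pullback_Vspace gr S1r p k (eta l)) : Vspace S2r p (etab k) l :=
  exist _ (val f) (mem_set (imV _ (set_valP f))).
have jE f : val (j f) = val f by [].
exists j; split; first exact: jE.
  apply: algebra_hom_incl; [|exact: Vloc_subalgebra|exact: jE].
  by apply: pullback_subalgebra; exact: Vloc_subalgebra.
apply/continuousP => U /seminorm_openP oU; apply/seminorm_openP => f Ujf.
have [D fD [e e0 DU]] := oU _ Ujf.
exists (preim @` D); first exact: finite_image.
exists e => // g1 g1D; apply: DU => K DK.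
apply: le_lt_trans (Vnorm2_le _ _) _.
have := g1D (preim K) (ex_intro2 _ _ K DK erefl).
set d := (X in Vnorm _ _ _ _ _ (X \o hr)).
have -> : d \o hr = (fun x => val g1 x - val f x); last exact.
by apply/funext => x; rewrite /d /= hrK.
Qed.
End Inclusions.

Lemma ring_transfer_of_pullback (R : realType) (u : R -> R) (Z' Z : Type)
    (S' : ball_system Z') (S : ball_system Z) (phi : Z' -> Z)
    (eta etab : Oplus u -> Oplus u) :
  ring_control (pullback_system phi S) S' eta etab ->
  ring_transfer S' S phi eta etab.
Proof.
move=> [lam [n0 [lam0 H]]]; exists lam, n0; split=> // k j n n0n a.
have [Hr Ho] := H k j n n0n; split=> [|] [b [nb kb h1 h2 h3]].
- by apply: Hr; exists b; split=> //; exact: preimage_subset.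
- by apply: Ho; exists b; split=> //; exact: preimage_subset.
Qed.

(** The control of the pull-back structure by S' is used through the inverse
    bijection, since preimage by psi undoes preimage by phi. *)
Lemma ring_transfer_to_pullback (R : realType) (u : R -> R) (Z' Z : Type)
    (S' : ball_system Z') (S : ball_system Z) (phi : Z' -> Z) (psi : Z -> Z')
    (eta etab : Oplus u -> Oplus u) : cancel phi psi -> cancel psi phi ->
  ring_control S' (pullback_system phi S) eta etab ->
  ring_transfer S S' psi eta etab.
Proof.
move=> phiK psiK [lam [n0 [lam0 H]]]; exists lam, n0; split=> // k j n n0n a.
have sub1 (A : set Z) (B : set Z') : phi @^-1` A `<=` B -> A `<=` psi @^-1` B.
  by move=> AB y Ay; apply: AB; rewrite /= psiK.
have sub2 (A : set Z) (B : set Z') : B `<=` phi @^-1` A -> psi @^-1` B `<=` A.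
  by move=> AB y /AB; rewrite /= psiK.
have [Hr Ho] := H k j n n0n; split=> [/Hr|/Ho] [b [nb kb h1 h2 h3]].
- exists b; split=> //=; [exact: sub1|exact: preimage_subset|exact: sub2].
- exists b; split=> //=; [exact: sub2| |exact: sub1].
  by move=> y by_; have := h2 (psi y); rewrite /= psiK; exact.
Qed.

Theorem lemma2p6 (R : realType) (u : R -> R) (Z : Type) (S : ball_system Z)
  (p : R) (k l : Oplus u)
  (hu : admissible u) (hS : qs_structure u S)
  (hlc : locally_compact [set: qs_space S])
  (hsc : @second_countable (qs_space S))
  (hp : 1 <= p) :
  (forall O : set (qs_space S), open O -> O !=set0 ->
     let V := Vloc (restr_system S O) p k l in
     let N := fun K : {K : set (set_type O) | compact K} =>
                Vnorm (restr_system S O) p k l (sval K) in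
     [/\ unital_subalgebra V, forall K, seminorm_on V (N K) &
         countably_seminormed V N]) /\
  (forall (Z' : Type) (S' : ball_system Z') (phi : qs_space S' -> qs_space S)
     (eta etab eta' etab' : Oplus u -> Oplus u),
     qs_structure u S' -> qs_homeo u S' S phi ->
     ring_control (pullback_system phi S) S' eta etab ->
     ring_control S' (pullback_system phi S) eta' etab' ->
     forall O' : set (qs_space S'), open O' ->
     let A := Vspace (restr_system S' O') p k (eta (eta' l)) in
     let B := pullback_Vspace (restr_map phi (A:=O'))
                (restr_system S (phi @` O')) p (etab k) (eta' l) in
     let C := Vspace (restr_system S' O') p (etab' (etab k)) l in
     (exists i : A -> B, [/\ forall f, val (i f) = val f,
        algebra_hom i & continuous i]) /\
     (exists j : B -> C, [/\ forall f, val (j f) = val f,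
        algebra_hom j & continuous j])).
Proof.
split=> [D oD _ V N|].
  split; [exact: Vloc_subalgebra|by move=> K; exact/Vnorm_seminorm/(svalP K)|].
  exact: Vloc_countably_seminormed.
move=> Z' S' phi eta etab eta' etab' hS' [[psi phiK psiK] _ _] T1 T2 O' oO' A B C.
have {}T1 := ring_transfer_of_pullback T1.
have {}T2 := ring_transfer_to_pullback phiK psiK T2.
(* The image of O' is its preimage by psi, which is continuous. *)
have oO : open (phi @` O').
  have -> : phi @` O' = psi @^-1` O'.
    apply/seteqP; split=> [_ [x O'x <-]|y O'y]; first by rewrite /= phiK.
    by exists (psi y) => //; rewrite psiK.
  have /continuousP := transfer_continuous hu hS' hS psiK T1 k.
  exact.
pose rr : O' -> (phi @` O') := restr_map phi (A:=O').
have inO' (y : phi @` O') : O' (psi (val y)).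
  by have [x O'x <-] := set_valP y; rewrite phiK.
pose gr (y : phi @` O') : O' := exist _ (psi (val y)) (mem_set (inO' y)).
have rrK : cancel rr gr by move=> x; apply: val_inj; rewrite /= phiK.
have grK : cancel gr rr by move=> x; apply: val_inj; rewrite /= psiK.
split.
- exact: (inclusion_to_pullback hu hS' hS phiK psiK T1 oO (hr := rr) (gr := gr)).
- exact: (inclusion_from_pullback hu hS hS' psiK phiK T2 oO' (hr := gr) (gr := rr)).
Qed.
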